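(* Let $n\ge2$ and let $\mathcal{R}=\mathbb{C}[\mathrm{Mat}_{2,n+1}]^{SO_2}$ be the algebra of $SO_2$-invariant polynomial functions on the space of complex $2\times(n+1)$ matrices $z=(z_{ij})$, where $SO_2$ is the group of complex matrices $\begin{pmatrix}u&-v\\ v&u\end{pmatrix}$ with $u^2+v^2=1$ (acting by left multiplication). Let $\mathcal{A}_\circ$ be the special cluster algebra of type $C_n$ defined in the context, whose cluster variables (resp. coefficient generators) are labeled by the $\Theta$-orbits of diagonals (resp. sides) of a regular $(2n+2)$-gon with vertices labeled $1,\dots,n+1,\overline1,\dots,\overline{n+1}$ in counterclockwise order. The correspondence sending each cluster variable and each coefficient for $\mathcal{A}_\circ$ to the element of $\mathcal{R}$ with the same label in the list $$\{[a,b],[\overline a,\overline b]\}\mapsto\Delta_{ab}=z_{1a}z_{2b}-z_{1b}z_{2a}\quad(1\le a<b\le n+1),$$ $$\{[a,\overline b],[\overline a,b]\}\mapsto\Delta_{a\overline b}=z_{1a}z_{1b}+z_{2a}z_{2b}\quad(1\le a\le b\le n+1)$$ (the case $a=b$ of the second line corresponding to the diameter $[a,\overline a]$) extends uniquely to an algebra isomorphism of $\mathcal{A}_\circ$ with a $\mathbb{Z}$-form of $\mathcal{R}$.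
   Context: Cluster algebras. A semifield $(\mathbb{P},\oplus,\cdot)$ is an abelian multiplicative group with a commutative, associative operation $\oplus$ over which multiplication distributes. $\mathrm{Trop}(p_j:j\in J)$ ($J$ finite) is the semifield whose multiplicative group is free abelian on the $p_j$, with $\prod_jp_j^{a_j}\oplus\prod_jp_j^{b_j}=\prod_jp_j^{\min(a_j,b_j)}$. The ambient field $\mathcal{F}$ is isomorphic to the field of rational functions in $n$ variables with coefficients in $\mathbb{Z}\mathbb{P}$. A seed is $(\mathbf{x},\mathbf{p},B)$ with $\mathbf{x}\subset\mathcal{F}$ an $n$-element transcendence basis over the fraction field of $\mathbb{Z}\mathbb{P}$; $\mathbf{p}=(p_x^\pm)_{x\in\mathbf{x}}$ in $\mathbb{P}$ with $p_x^+\oplus p_x^-=1$; $B=(b_{xy})_{x,y\in\mathbf{x}}$ an integer matrix with, for all $x,y$, either $b_{xy}=b_{yx}=0$ or $b_{xy}b_{yx}<0$. Mutation at $z\in\mathbf{x}$: replace $z$ by $\overline z$ given by the exchange relation $z\overline z=p_z^+\prod_{b_{xz}>0}x^{b_{xz}}+p_z^-\prod_{b_{xz}<0}x^{-b_{xz}}$; new coefficients are normalized and satisfy $\overline p_x^+/\overline p_x^-=p_z^-/p_z^+$ if $x=\overline z$, $=(p_z^+)^{b_{zx}}p_x^+/p_x^-$ if $b_{zx}\ge0$, $=(p_z^-)^{b_{zx}}p_x^+/p_x^-$ if $b_{zx}\le0$; $B$ is replaced by $b'_{xy}=-b_{xy}$ if $x=z$ or $y=z$, $b'_{xy}=b_{xy}+\frac{|b_{xz}|b_{zy}+b_{xz}|b_{zy}|}{2}$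 otherwise, with the index $z$ relabeled $\overline z$. The cluster algebra generated from an initial seed is the subring of $\mathcal{F}$ generated by all cluster variables (elements of the sets $\mathbf{x}$) and all coefficients $p_x^\pm$ of all seeds obtained by iterated mutations. It is of type $C_n$ if some seed matrix $B$ has Cartan counterpart ($a_{xx}=2$, $a_{xy}=-|b_{xy}|$ for $x\neq y$) the Cartan matrix of type $C_n$, in the convention $a_{n-1,n}=-2$, $a_{n,n-1}=-1$. The algebra $\mathcal{A}_\circ$ of type $C_n$. Let $\Theta$ be the $180^\circ$ rotation of the regular $(2n+2)$-gon $\mathbf{P}_{2n+2}$, and $\overline a=\Theta(a)$ the vertex antipodal to $a$ (so $\overline{\overline a}=a$). The $\Theta$-orbits of diagonals are the diameters $[a,\overline a]$ and the pairs $\{[a,b],[\overline a,\overline b]\}$ of centrally symmetric non-diameter diagonals. Let $\mathbb{P}=\mathrm{Trop}(p_\delta)$, where $\delta$ runs over the $n+1$ centrally symmetric pairs of sides; for $\delta=\{[a,b],[\overline a,\overline b]\}$ write $p_\delta=p_{ab}=p_{\overline a\,\overline b}$. $\mathcal{A}_\circ$ is the cluster algebra of type $C_n$ over $\mathbb{P}$ whose cluster variables $x_{ab}=x_{ba}=x_{\overline a\,\overline b}$ are labeled by the $\Theta$-orbits of diagonals $[a,b]$, whose clusters correspond to the $\Theta$-invariant triangulations of $\mathbf{P}_{2n+2}$ by non-crossing diagonals, and whose exchange relations are the following (with the convention $x_{ab}=1$ if $[a,b]$ is a side): (1) $x_{ac}x_{bd}=p^+x_{ab}x_{cd}+p^-x_{ad}x_{bc}$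 whenever $a,b,c,d,\overline a$ are in counterclockwise order; (2) $x_{ac}x_{a\overline b}=p^+x_{ab}x_{a\overline c}+p^-x_{a\overline a}x_{bc}$ whenever $a,b,c,\overline a$ are in counterclockwise order; (3) $x_{a\overline a}x_{b\overline b}=p^+x_{ab}^2+p^-x_{a\overline b}^2$ whenever $a,b,\overline a$ are in counterclockwise order. Here, in each relation, the coefficient of a monomial is obtained from that monomial by replacing each factor $x_{ab}$ by $1$ if $[a,b]$ is a diagonal and by $p_{ab}$ if $[a,b]$ is a side (so, e.g., $x_{ab}^2$ gives $p_{ab}^2$ when $[a,b]$ is a side). Such a cluster algebra exists, and the matrix and coefficients of a seed are read off from the exchange relations, up to the simultaneous change $B\to-B$, $p^+\leftrightarrow p^-$, which does not affect the algebra. A $\mathbb{Z}$-form of a commutative $\mathbb{C}$-algebra $R$ is a subring $R_{\mathbb{Z}}$ with $\mathbb{C}\otimes_{\mathbb{Z}}R_{\mathbb{Z}}\cong R$ via multiplication. *)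

(* Defs.v *)
From HB Require Import structures.
From mathcomp Require Import all_boot all_order perm all_algebra.
From mathcomp Require Import boolp reals.
From mathcomp Require Import complex.
From mathcomp Require Import mpoly.

Set Implicit Arguments.
Unset Strict Implicit.
Unset Printing Implicit Defensive.

Import Order.TTheory GRing.Theory Num.Theory.
Local Open Scope ring_scope.

Definition subring_span (R : nzRingType) (X : R -> Prop) : {pred R} :=
  fun y => `[< forall S : subringClosed R,
                 (forall x, X x -> x \in S) -> y \in S >].

Fact subring_span_closed (R : nzRingType) (X : R -> Prop) :
  subring_closed (subring_span X).
Proof.
split=> [|x y /asboolP hx /asboolP hy|x y /asboolP hx /asboolP hy];
  apply/asboolP => S hS.
- exact: rpred1.
- by rewrite rpredB ?hx ?hy.
- by rewrite rpredM ?hx ?hy.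
Qed.

HB.instance Definition _ (R : nzRingType) (X : R -> Prop) :=
  GRing.isSubringClosed.Build R (subring_span X) (subring_span_closed X).

Definition subfield_span (F : fieldType) (X : F -> Prop) : {pred F} :=
  fun y => `[< forall S : divringClosed F,
                 (forall x, X x -> x \in S) -> y \in S >].

Fact subfield_span_closed (F : fieldType) (X : F -> Prop) :
  divring_closed (subfield_span X).
Proof.
split=> [|x y /asboolP hx /asboolP hy|x y /asboolP hx /asboolP hy];
  apply/asboolP => S hS.
- exact: rpred1.
- by rewrite rpredB ?hx ?hy.
- by rewrite rpred_div ?hx ?hy.
Qed.

HB.instance Definition _ (F : fieldType) (X : F -> Prop) :=
  GRing.isDivringClosed.Build F (subfield_span X) (subfield_span_closed X).

Definition subring_of (R : comNzRingType) (S : subringClosed R) : Type :=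
  {x : R | x \in S}.
HB.instance Definition _ (R : comNzRingType) (S : subringClosed R) :=
  SubChoice.copy (subring_of S) {x : R | x \in S}.
HB.instance Definition _ (R : comNzRingType) (S : subringClosed R) :=
  [SubChoice_isSubComNzRing of subring_of S by <:].

Definition biadditive (A B G : zmodType) (f : A -> B -> G) : Prop :=
  (forall a a' b, f (a + a') b = f a b + f a' b) /\
  (forall a b b', f a (b + b') = f a b + f a b').

(* The tensor product over Z, by its universal property: the map A (x) B -> T
   induced by mu is an isomorphism. *)
Definition is_tensor_product (A B T : zmodType) (mu : A -> B -> T) : Prop :=
  biadditive mu /\
  forall (G : zmodType) (f : A -> B -> G), biadditive f ->
    exists h : {additive T -> G},
      (forall a b, h (mu a b) = f a b) /\
      (forall h' : {additive T -> G},
         (forall a b, h' (mu a b) = f a b) -> h' =1 h).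

Definition is_Zform (C : fieldType) (R : comAlgType C) (RZ : subringClosed R)
    : Prop :=
  is_tensor_product (fun (c : C) (r : subring_of RZ) => c *: \val r : R).

HB.mixin Record isSemifield P of Group P := {
  sf_add : P -> P -> P;
  sf_mulC : commutative (fun p q : P => (p * q)%g);
  sf_addA : associative sf_add;
  sf_addC : commutative sf_add;
  sf_mulDr : forall p q r : P, (p * sf_add q r = sf_add (p * q) (p * r))%g
}.

#[short(type="semifieldType")]
HB.structure Definition Semifield := {P of isSemifield P & Group P}.

Notation "p \oplus q" := (sf_add p q) (at level 50, left associativity).

(* A Laurent monomial is represented by its vector of exponents. *)
Definition trop (J : finType) : Type := {ffun J -> int}.

Section TropStructure.
Context (J : finType).
HB.instance Definition _ := Choice.on (trop J).
Let mulT (p q : trop J) : trop J := [ffun j => p j + q j].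
Let oneT : trop J := [ffun=> 0].
Let invT (p : trop J) : trop J := [ffun j => - p j].
Let addT (p q : trop J) : trop J := [ffun j => Order.min (p j) (q j)].

Fact trop_mulA : associative mulT.
Proof. by move=> p q r; apply/ffunP=> j; rewrite !ffunE addrA. Qed.
Fact trop_mul1 : left_id oneT mulT.
Proof. by move=> p; apply/ffunP=> j; rewrite !ffunE add0r. Qed.
Fact trop_mulr1 : right_id oneT mulT.
Proof. by move=> p; apply/ffunP=> j; rewrite !ffunE addr0. Qed.
Fact trop_mulV : left_inverse oneT invT mulT.
Proof. by move=> p; apply/ffunP=> j; rewrite !ffunE addNr. Qed.
Fact trop_mulrV : right_inverse oneT invT mulT.
Proof. by move=> p; apply/ffunP=> j; rewrite !ffunE addrN. Qed.

HB.instance Definition _ := isGroup.Build (trop J)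
  trop_mulA trop_mul1 trop_mulr1 trop_mulV trop_mulrV.

Fact trop_mulC : commutative (fun p q : trop J => (p * q)%g).
Proof. by move=> p q; apply/ffunP=> j; rewrite !ffunE addrC. Qed.
Fact trop_addA : associative addT.
Proof. by move=> p q r; apply/ffunP=> j; rewrite !ffunE minA. Qed.
Fact trop_addC : commutative addT.
Proof. by move=> p q; apply/ffunP=> j; rewrite !ffunE minC. Qed.
Fact trop_mulDr (p q r : trop J) : (p * addT q r = addT (p * q) (p * r))%g.
Proof. by apply/ffunP=> j; rewrite !ffunE addr_minr. Qed.

HB.instance Definition _ := isSemifield.Build (trop J)
  trop_mulC trop_addA trop_addC trop_mulDr.
End TropStructure.

(* The fraction field of ZP inside F, for iota the inclusion of P into F. *)
Definition fracZP (P : semifieldType) (F : fieldType) (iota : P -> F) :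
    {pred F} :=
  subfield_span (fun f => exists p, f = iota p).

Definition adjoin (F : fieldType) (n : nat) (K : {pred F}) (x : 'I_n -> F) :
    {pred F} :=
  subfield_span (fun f => f \in K \/ exists i, f = x i).

Definition alg_independent (F : fieldType) (n : nat) (K : {pred F})
    (x : 'I_n -> F) : Prop :=
  forall q : {mpoly F[n]}, q \is a mpolyOver n K -> q.@[x] = 0 -> q = 0.

Definition transcendence_basis (F : fieldType) (n : nat) (K : {pred F})
    (x : 'I_n -> F) : Prop :=
  alg_independent K x /\
  forall f : F, exists q : {poly F},
    [/\ q \is a polyOver (adjoin K x), q != 0 & root q f].

(* iota identifies ZP with a subring of F, and F is the field of rational
   functions over ZP in n variables. *)
Record ambient_field (P : semifieldType) (n : nat) (F : fieldType)
    (iota : P -> F) : Prop := {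
  iota_mul : {morph iota : p q / (p * q)%g >-> p * q};
  iota_neq0 : forall p, iota p != 0;
  iota_free : forall (s : seq P) (c : P -> int), uniq s ->
    \sum_(p <- s) iota p *~ c p = 0 -> forall p, p \in s -> c p = 0;
  iota_rational : exists y : 'I_n -> F,
    alg_independent (fracZP iota) y /\
    forall f, f \in adjoin (fracZP iota) y
}.

(* Clusters are indexed by 'I_n; an exchange keeps the index of the exchanged
   variable. *)
Record seed (P : semifieldType) (n : nat) (F : fieldType) (iota : P -> F) :
    Type := Seed {
  cvar : 'I_n -> F;
  pplus : 'I_n -> P;
  pminus : 'I_n -> P;
  exmx : 'M[int]_n;
  seed_basis : transcendence_basis (fracZP iota) cvar;
  seed_normalized : forall i, pplus i \oplus pminus i = 1%g;
  seed_sign : forall i j,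
    (exmx i j = 0 /\ exmx j i = 0) \/ exmx i j * exmx j i < 0
}.

Section Cluster.
Context (P : semifieldType) (n : nat) (F : fieldType) (iota : P -> F).
Implicit Types s : seed n iota.

Definition monp s (k : 'I_n) : F :=
  \prod_(i < n | 0 < exmx s i k) cvar s i ^+ `|exmx s i k|%N.

Definition monm s (k : 'I_n) : F :=
  \prod_(i < n | exmx s i k < 0) cvar s i ^+ `|exmx s i k|%N.

Definition coef_ratio s (i : 'I_n) : P := (pplus s i / pminus s i)%g.

Record mutation (k : 'I_n) (s s' : seed n iota) : Prop := {
  mut_var : forall i, i != k -> cvar s' i = cvar s i;
  mut_exchange : cvar s k * cvar s' k =
    iota (pplus s k) * monp s k + iota (pminus s k) * monm s k;
  mut_coef_k : coef_ratio s' k = (pminus s k / pplus s k)%g;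
  mut_coef_pos : forall i, i != k -> 0 <= exmx s k i ->
    coef_ratio s' i = (pplus s k ^+ `|exmx s k i|%N * coef_ratio s i)%g;
  mut_coef_neg : forall i, i != k -> exmx s k i <= 0 ->
    coef_ratio s' i = (pminus s k ^- `|exmx s k i|%N * coef_ratio s i)%g;
  (* the division by 2 is exact *)
  mut_exmx : forall i j, exmx s' i j =
    if (i == k) || (j == k) then - exmx s i j
    else exmx s i j +
      ((`|exmx s i k| * exmx s k j + exmx s i k * `|exmx s k j|) %/ 2)%Z
}.

Inductive reachable (s0 : seed n iota) : seed n iota -> Prop :=
| reachable_refl : reachable s0 s0
| reachable_step s s' k :
    reachable s0 s -> mutation k s s' -> reachable s0 s'.

Definition cluster_variable (s0 : seed n iota) (y : F) : Prop :=
  exists s i, reachable s0 s /\ y = cvar s i.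

Definition cluster_coefficient (s0 : seed n iota) (y : F) : Prop :=
  exists s i, reachable s0 s /\
    (y = iota (pplus s i) \/ y = iota (pminus s i)).

Definition cluster_algebra (s0 : seed n iota) : subringClosed F :=
  subring_span (fun y => cluster_variable s0 y \/ cluster_coefficient s0 y).

Definition cartan_counterpart (B : 'M[int]_n) : 'M[int]_n :=
  \matrix_(i, j) (if i == j then 2 else - `|B i j|).

(* With 1-based indices, the entry -2 is a_{n-1,n}. *)
Definition cartan_C : 'M[int]_n :=
  \matrix_(i, j)
    (if i == j then 2
     else if (i.+1 == j) && (j.+1 == n) then - 2%:Z
     else if (i.+1 == j) || (j.+1 == i) then - 1
     else 0).

Definition type_C (s0 : seed n iota) : Prop :=
  exists s, reachable s0 s /\ exists sigma : 'S_n, forall i j,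
    cartan_counterpart (exmx s) (sigma i) (sigma j) = cartan_C i j.

(* cluster_exchange s0 z z' t t': the exchange relation
   z * z' = p^+ M^+ + p^- M^-, with t = (p^+, M^+) and t' = (p^-, M^-),
   occurs between two adjacent seeds. *)
Definition cluster_exchange (s0 : seed n iota) (z z' : F) (t t' : P * F) :
    Prop :=
  exists s s' k, [/\ reachable s0 s, mutation k s s',
    (z, z') = (cvar s k, cvar s' k),
    t = (pplus s k, monp s k) & t' = (pminus s k, monm s k)].

End Cluster.

(* The vertices, in counterclockwise order, are the integers mod 2n+2. *)
Notation vertex n := ('I_(n.*2.+2)).

Section Polygon.
Context (n : nat).
Implicit Types (a b c d : vertex n) (e : {set vertex n}).

Definition bar a : vertex n := a + n.+1%:R.

Definition ccw (s : seq (vertex n)) : bool :=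
  if s is a :: _ then sorted ltn [seq val (b - a) | b <- s] else true.

Definition is_side e : bool := [exists a, e == [set a; a + 1]].

Definition is_diagonal e : bool := (#|e| == 2) && ~~ is_side e.

Definition crossing e e' : bool :=
  [exists a, exists b, exists c, exists d,
    [&& e == [set a; c], e' == [set b; d] & ccw [:: a; b; c; d]]].

Definition triangulation (T : {set {set vertex n}}) : bool :=
  maxset (fun S : {set {set vertex n}} =>
    [forall e in S, is_diagonal e] &&
    [forall e in S, forall e' in S, ~~ crossing e e']) T.

Definition Theta e : {set vertex n} := bar @: e.

Definition Theta_invariant (T : {set {set vertex n}}) : bool :=
  Theta @: T == T.

Definition Theta_orbit e : {set {set vertex n}} := [set e; Theta e].

Definition orbit_of a b : {set {set vertex n}} := Theta_orbit [set a; b].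

Definition side_orbits : {set {set {set vertex n}}} :=
  [set Theta_orbit e | e in is_side].

Definition diagonal_orbits : {set {set {set vertex n}}} :=
  [set Theta_orbit e | e in is_diagonal].

(* polygon_exchange o o' m m': the relation
   x_o * x_o' = p^+ * (monomial m) + p^- * (monomial m')
   is one of the defining exchange relations; a monomial is given by the list
   of its factors, including the sides. *)
Inductive polygon_exchange : {set {set vertex n}} -> {set {set vertex n}} ->
    seq {set {set vertex n}} -> seq {set {set vertex n}} -> Prop :=
| polygon_exchange1 a b c d : ccw [:: a; b; c; d; bar a] ->
    polygon_exchange (orbit_of a c) (orbit_of b d)
      [:: orbit_of a b; orbit_of c d] [:: orbit_of a d; orbit_of b c]
| polygon_exchange2 a b c : ccw [:: a; b; c; bar a] ->
    polygon_exchange (orbit_of a c) (orbit_of a (bar b))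
      [:: orbit_of a b; orbit_of a (bar c)]
      [:: orbit_of a (bar a); orbit_of b c]
| polygon_exchange3 a b : ccw [:: a; b; bar a] ->
    polygon_exchange (orbit_of a (bar a)) (orbit_of b (bar b))
      [:: orbit_of a b; orbit_of a b]
      [:: orbit_of a (bar b); orbit_of a (bar b)].

End Polygon.

Definition side_pair (n : nat) : Type :=
  {o : {set {set vertex n}} | o \in side_orbits n}.
HB.instance Definition _ (n : nat) := SubFinite.copy (side_pair n)
  {o : {set {set vertex n}} | o \in side_orbits n}.

Notation tropC n := (trop (side_pair n)).

(* The generator p_o of tropC n if o is a pair of sides, and 1 otherwise. *)
Definition side_coef (n : nat) (o : {set {set vertex n}}) : tropC n :=
  [ffun j => (val j == o)%:Z].

Section Acirc.
Context (n : nat) (F : fieldType) (iota : tropC n -> F).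
(* Only the values of x on diagonal_orbits n are meaningful. *)
Context (x : {set {set vertex n}} -> F).

Definition side_var (o : {set {set vertex n}}) : F :=
  if o \in side_orbits n then 1 else x o.

Definition term (m : seq {set {set vertex n}}) : tropC n * F :=
  ((\prod_(o <- m) side_coef o)%g, \prod_(o <- m) side_var o).

(* The relation z * z' = t + t' is unordered in (z, z') and in (t, t'). *)
Definition same_exchange (z z' : F) (t t' : tropC n * F)
    (w w' : F) (u u' : tropC n * F) : Prop :=
  ((z, z') = (w, w') \/ (z, z') = (w', w)) /\
  ((t, t') = (u, u') \/ (t, t') = (u', u)).

Definition is_cluster_of (s : seed n iota) (T : {set {set vertex n}}) : Prop :=
  forall y, (exists i, y = cvar s i) <->
            (exists2 e, e \in T & y = x (Theta_orbit e)).

(* s0 is a seed of A_circ and x is the labeling of the cluster variables. *)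
Record is_Acirc (s0 : seed n iota) : Prop := {
  Acirc_type : type_C s0;
  Acirc_label_inj : {in diagonal_orbits n &, injective x};
  Acirc_label : forall y, cluster_variable s0 y <->
    exists2 o, o \in diagonal_orbits n & y = x o;
  Acirc_cluster : forall s, reachable s0 s ->
    exists T, [/\ triangulation T, Theta_invariant T & is_cluster_of s T];
  Acirc_triangulation : forall T, triangulation T -> Theta_invariant T ->
    exists2 s, reachable s0 s & is_cluster_of s T;
  Acirc_exchange : forall z z' t t', cluster_exchange s0 z z' t t' ->
    exists o o' m m', polygon_exchange o o' m m' /\
      same_exchange z z' t t' (x o) (x o') (term m) (term m');
  Acirc_exchange_all : forall o o' m m', polygon_exchange o o' m m' ->
    exists z z' t t', cluster_exchange s0 z z' t t' /\
      same_exchange z z' t t' (x o) (x o') (term m) (term m')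
}.

(* The cluster variable, or coefficient generator, labeled by o. *)
Definition labeled (o : {set {set vertex n}}) : F :=
  if o \in side_orbits n then iota (side_coef o) else x o.

End Acirc.

Section Invariants.
Context (C : fieldType) (n : nat).

Notation mxpol := {mpoly C[2 * n.+1]}.

Definition zcoord (i : 'I_2) (a : 'I_n.+1) : mxpol := 'X_(mxvec_index i a).

Definition eval_mx (f : mxpol) (M : 'M[C]_(2, n.+1)) : C :=
  f.@[fun k => mxvec M 0 k].

Definition rot2 (u v : C) : 'M[C]_2 :=
  \matrix_(i, j) (if i == j then u else if i == 0 then - v else v).

Definition so2_invariant : {pred mxpol} :=
  fun f => `[< forall u v : C, u ^+ 2 + v ^+ 2 = 1 ->
    forall M, eval_mx f (rot2 u v *m M) = eval_mx f M >].

Fact so2_invariant_closed : subalg_closed so2_invariant.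
Proof.
split=> [|c f g /asboolP hf /asboolP hg|f g /asboolP hf /asboolP hg];
  apply/asboolP => u v huv M; rewrite /eval_mx.
- by rewrite !mevalC.
- by rewrite !mevalD !mevalZ; move: (hf u v huv M) (hg u v huv M);
    rewrite /eval_mx => -> ->.
- by rewrite !mevalM; move: (hf u v huv M) (hg u v huv M);
    rewrite /eval_mx => -> ->.
Qed.

HB.instance Definition _ :=
  GRing.isSubalgClosed.Build C mxpol so2_invariant so2_invariant_closed.

Definition so2_invariants : Type := {f : mxpol | f \in so2_invariant}.
HB.instance Definition _ :=
  SubChoice.copy so2_invariants {f : mxpol | f \in so2_invariant}.
HB.instance Definition _ := [SubChoice_isSubComNzRing of so2_invariants by <:].
HB.instance Definition _ := [SubZmodule_isSubLmodule of so2_invariants by <:].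
HB.instance Definition _ :=
  [SubNzRing_SubLmodule_isSubLalgebra of so2_invariants by <:].
HB.instance Definition _ :=
  [SubLalgebra_isSubAlgebra of so2_invariants by <:].

Definition Delta (a b : 'I_n.+1) : mxpol :=
  zcoord 0 a * zcoord 1 b - zcoord 0 b * zcoord 1 a.

(* The element written Delta_{a, bar b}, for a <= b. *)
Definition Deltabar (a b : 'I_n.+1) : mxpol :=
  zcoord 0 a * zcoord 0 b + zcoord 1 a * zcoord 1 b.

End Invariants.

(* vtx a is the unbarred vertex labeled a + 1. *)
Definition vtx (n : nat) (a : 'I_n.+1) : vertex n := inord a.

Section Labels.
Context (C : fieldType) (n : nat) (F : fieldType) (iota : tropC n -> F).
Context (x : {set {set vertex n}} -> F) (s0 : seed n iota).
Context (RZ : subringClosed (so2_invariants C n)).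

Definition extends_labels
    (f : subring_of (cluster_algebra s0) -> subring_of RZ) : Prop :=
  (forall a b : 'I_n.+1, (a < b)%N ->
     exists2 y, \val y = labeled iota x (orbit_of (vtx a) (vtx b)) &
                \val (\val (f y)) = Delta C a b) /\
  (forall a b : 'I_n.+1, (a <= b)%N ->
     exists2 y, \val y = labeled iota x (orbit_of (vtx a) (bar (vtx b))) &
                \val (\val (f y)) = Deltabar C a b).

Definition Zform_isomorphism
    (f : {rmorphism subring_of (cluster_algebra s0) -> subring_of RZ}) : Prop :=
  [/\ is_Zform RZ, bijective f & extends_labels f].

End Labels.

(* Main.v *)
Require Import Defs.
From HB Require Import structures.
From mathcomp Require Import all_boot all_order perm all_algebra.
From mathcomp Require Import boolp reals.
From mathcomp Require Import complex.
From mathcomp Require Import mpoly.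
From mathcomp Require Import zify ring.

Set Implicit Arguments.
Unset Strict Implicit.
Unset Printing Implicit Defensive.

Import Order.TTheory GRing.Theory Num.Theory.
Local Open Scope ring_scope.

(** Let [v_1, ..., v_(n+1)] be the columns of the matrix [z], let [J] be the
    quarter turn of the plane, and put [v_(bar a) = J v_a].  Since [J ^ 2 = -1],
    walking once around the polygon changes the sign of [v_a], and both lines of
    the list in the statement say that the orbit of [[a, b]] goes to
    [det (v_a, v_b)] for the representatives [a < b] within one turn.  The three
    exchange relations are then the three-term Pluecker relation for the points
    [a, b, c, d], for [a, b, c, bar a] and for [a, b, bar a, bar b].  Once the
    coefficients are written as labels of the sides, the labels in the ambient
    field satisfy the same relations ([label_ptolemy_system] and
    [Delta_ptolemy_system]).

    The two sides are compared through the fan triangulation formed by the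
    diagonals [[1, b]], their images [[bar 1, bar b]] and the diameter
    [[1, bar 1]].  The exchange relations alone express every label as a
    rational function of the [n] labels of the fan and of the [n + 1] labels of
    the sides ([fan_generates]).  These [2 n + 1] elements are algebraically
    independent over the integers in both worlds: in the ambient field because
    the fan is the cluster of a seed ([fan_seed], [label_evaluation_inj]), and
    among polynomials in [z] because one can find vectors [v_a] for which the
    minors in question take arbitrarily prescribed nonzero values
    ([reconstruction], [Delta_evaluation_inj]).  Hence an element of the subring
    of the product of the two worlds generated by the pairs (label of an
    orbit, corresponding minor) has its two components given by one and the
    same fraction, and one component vanishes exactly when the other does
    ([graph_eq0]).  This subring is therefore the graph of an isomorphism from
    the ring generated by the labels onto the ring generated by the minors.

    It remains to identify these two rings.  The first one is the cluster
    algebra ([cluster_algebra_sub_labels], [label_cluster_algebra]).  The point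
    is that the coefficients of a reachable seed at any index do occur in an
    exchange relation, which holds because every reachable seed can be mutated
    in every direction ([mutation_exists]): exchange matrices are
    skew-symmetrizable, since one of them is of type [C_n], so a mutated matrix
    has the sign pattern that a seed requires.  The second ring is a Z-form of
    the invariants ([minor_Zform]).  Products of minors span the invariants, by the
    first fundamental theorem for [SO_2] ([so2_invariant_generated]), which in
    isotropic coordinates is a statement about weights of monomials.  No
    relation over [C] creates a collapse, because the minors have integer
    coefficients and linear relations between integer vectors can be cleared by
    a Smith normal form ([integral_relation]).

    Uniqueness follows at once from the fact that the labels generate the
    cluster algebra. *)

(** * Spans and points off a hypersurface *)

Lemma subring_span_gen (R : nzRingType) (X : R -> Prop) x :
  X x -> x \in subring_span X.
Proof. by move=> Xx; apply/asboolP => S; apply. Qed.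

Lemma subring_span_ind (R : nzRingType) (X P : R -> Prop) :
  P 1 -> (forall x y, P x -> P y -> P (x - y)) ->
  (forall x y, P x -> P y -> P (x * y)) -> (forall x, X x -> P x) ->
  forall y, y \in subring_span X -> P y.
Proof.
move=> P1 PB PM XP y /asboolP hy.
have cl : subring_closed ((fun z => `[< P z >]) : {pred R}).
  split=> [|u v|u v]; rewrite ?unfold_in.
  - exact/asboolP.
  - by move=> /asboolP ? /asboolP ?; apply/asboolP/PB.
  - by move=> /asboolP ? /asboolP ?; apply/asboolP/PM.
pose S : subringClosed R :=
  HB.pack ((fun z => `[< P z >]) : {pred R}) (GRing.isSubringClosed.Build R _ cl).
have : y \in S by apply: hy => x Xx; apply/asboolP/XP.
by move/asboolP.
Qed.

Lemma subfield_span_gen (F : fieldType) (X : F -> Prop) x :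
  X x -> x \in subfield_span X.
Proof. by move=> Xx; apply/asboolP => S; apply. Qed.

Lemma subfield_span_sub (F : fieldType) (X Y : F -> Prop) :
  (forall x, X x -> x \in subfield_span Y) ->
  {subset subfield_span X <= subfield_span Y}.
Proof. by move=> XY y /asboolP hy; apply: (hy (subfield_span Y)). Qed.

(** By induction on the number of variables, seeing the last variable as the
    variable of a univariate polynomial, which misses one of the nonzero
    naturals as a root.  The nonvanishing of the coordinates serves
    [reconstruction], where the coordinates are denominators. *)
Lemma mpoly_nonroot (C : numDomainType) (n : nat) (p : {mpoly C[n]}) :
  p != 0 -> exists v : 'I_n -> C, (forall i, v i != 0) /\ p.@[v] != 0.
Proof.
elim: n p => [|n IHn] p p0.
  exists (fun=> 1); split=> [i|]; first exact: oner_neq0.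
  have pE : p = (p@_0%MM)%:MP.
    apply/mpolyP => m; rewrite mcoeffC.
    have -> : m = 0%MM by apply/mnmP => -[].
    by rewrite eqxx mulr1.
  by apply: contraNneq p0; rewrite pE mevalC => ->; rewrite mpolyC0.
(* Forgetting the exponent of the last variable, as [muni] does. *)
pose rs (m : 'X_{1..n.+1}) := [multinom m (widen_ord (leqnSn n) i) | i < n].
have muniN0 : muni p != 0.
  apply: contraNneq p0 => mp0; apply/eqP/mpolyP => m0; rewrite mcoeff0.
  case: (boolP (m0 \in msupp p)) => [m0p|/memN_msupp_eq0 //].
  have := congr1 (fun q : {poly {mpoly C[n]}} => q`_(m0 ord_max)@_(rs m0)) mp0.
  rewrite /= coef0 mcoeff0 muniE coef_sum raddf_sum /=.
  rewrite (bigD1_seq m0) ?msupp_uniq //= big1 => [|m m_m0].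
    by rewrite addr0 coefZ coefXn eqxx mulr1 mcoeffZ mcoeffX eqxx mulr1.
  rewrite coefZ coefXn; case: eqP => [Emax|]; last by rewrite mulr0 mcoeff0.
  rewrite mulr1 mcoeffZ mcoeffX; case: eqP => [Ers|]; last by rewrite mulr0.
  case/eqP: m_m0; apply/mnmP => i.
  case: (unliftP ord_max i) => [j ->|->]; last by rewrite Emax.
  have /mnmP /(_ j) := Ers; rewrite !mnmE.
  have -> // : widen_ord (leqnSn n) j = lift ord_max j.
  by apply/val_inj; rewrite /= /bump leqNgt ltn_ord.
have [k qk0] : exists k, (muni p)`_k != 0.
  by exists (size (muni p)).-1; rewrite -lead_coefE lead_coef_eq0.
have [v [v0 qv0]] := IHn _ qk0.
pose r := map_poly (meval v) (muni p).
have r0 : r != 0.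
  apply: contraNneq qv0 => /(congr1 (fun q : {poly C} => q`_k)).
  by rewrite coef0 coef_map /= => ->.
have [t t0 rt] : exists2 t, t != 0 & r.[t] != 0.
  pose s := [seq i.+1%:R : C | i <- iota 0 (size r)].
  have us : uniq s.
    by rewrite map_inj_uniq ?iota_uniq // => i j /eqP; rewrite eqr_nat eqSS => /eqP.
  have /allPn [t ts] : ~~ all (root r) s.
    by apply/negP => /max_poly_roots -/(_ r0 us); rewrite size_map size_iota ltnn.
  by exists t => //; case/mapP: ts => i _ ->; rewrite pnatr_eq0.
pose v' (i : 'I_n.+1) := if unlift ord_max i is Some j then v j else t.
exists v'; split=> [i|]; first by rewrite /v'; case: unliftP.
suff -> : p.@[v'] = r.[t] by [].
rewrite mevalE /r muniE raddf_sum /= horner_sum; apply: eq_bigr => m _.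
rewrite map_polyZ map_polyXn hornerZ hornerXn /= mevalZ mevalX -mulrA; congr (_ * _).
rewrite big_ord_recr /= {2}/v' unlift_none; congr (_ * _); apply: eq_bigr => i _.
rewrite mnmE /v'; have -> : widen_ord (leqnSn n) i = lift ord_max i.
  by apply/val_inj; rewrite /= /bump leqNgt ltn_ord.
rewrite liftK; congr (_ ^+ m _); apply/val_inj; by rewrite /= /bump leqNgt ltn_ord.
Qed.

(** * Matrix mutation and exchange of one algebraically independent element *)

(** Evaluation at the generic point of the field of rational functions. *)
Lemma mmap_id_frac (F : fieldType) (n : nat) (q : {mpoly F[n]}) :
  mmap (@tofrac {mpoly F[n]} \o @mpolyC n F) (fun i => @tofrac {mpoly F[n]} 'X_i) q =
  @tofrac {mpoly F[n]} q.
Proof.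
rewrite [q in RHS]mpolyE raddf_sum /=; apply: eq_bigr => m _.
by rewrite -mul_mpolyC rmorphM /= mpolyXE_id rmorph_prod /=; congr (_ * _);
  apply: eq_bigr => i _; rewrite rmorphXn.
Qed.

Section ExchangeIndependence.
Context (F : fieldType) (n : nat) (k : 'I_n) (r : {mpoly F[n]}).
Hypothesis r_free : forall m, m \in msupp r -> m k = 0%N.

Lemma mmap_free (L : comNzRingType) (f : {rmorphism F -> L}) (y y' : 'I_n -> L) :
  (forall i, i != k -> y i = y' i) -> mmap f y r = mmap f y' r.
Proof.
move=> yy'; apply: eq_big_seq => m /r_free mk0; congr (_ * _).
apply: eq_bigr => i _; case: (eqVneq i k) => [->|/yy' -> //].
by rewrite mk0 !expr0.
Qed.

(** Replacing [x_k] by [r / x_k] and clearing denominators turns [x_k ^ e] into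
    [r ^ e * x_k ^ (d - e)]; this and [flip_poly] implement that substitution
    inside the polynomial ring. *)
Definition flip_exponent (d : nat) (m : 'X_{1..n}) : 'X_{1..n} :=
  [multinom if i == k then (d - m k)%N else m i | i < n].

Definition flip_poly (q : {mpoly F[n]}) : {mpoly F[n]} :=
  \sum_(m <- msupp q) q@_m *: (r ^+ m k * 'X_[flip_exponent (msize q) m]).

(** Stated for an arbitrary field of values because it is applied twice: at the
    given independent family, and at a generic point. *)
Lemma mmap_flip (L : fieldType) (f : {rmorphism F -> L}) (y y' : 'I_n -> L) q :
  (forall i, i != k -> y i = y' i) -> y k * y' k = mmap f y r ->
  mmap f y (flip_poly q) = y k ^+ msize q * mmap f y' q.
Proof.
move=> yy' yk; rewrite /flip_poly raddf_sum /= [in RHS]/mmap mulr_sumr.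
apply: eq_big_seq => m mq.
rewrite mmapZ rmorphM rmorphXn /= -yk mmapX [RHS]mulrCA; congr (_ * _).
rewrite /mmap1 (bigD1 k) //= [in RHS](bigD1 k) //= mnmE eqxx.
rewrite !mulrA; congr (_ * _); last first.
  by apply: eq_bigr => i ik; rewrite mnmE (negbTE ik) yy'.
rewrite exprMn mulrAC -exprD subnKC //.
by apply: leq_trans (ltnW (msize_mdeg_lt mq)); rewrite mdegE (bigD1 k) //= leq_addr.
Qed.

(** A relation [q] for [x'] gives, by clearing denominators, the relation
    [flip_poly q] for [x], which must therefore be the zero polynomial; as the
    substitution is invertible over the rational functions, [q] is zero too. *)
Lemma alg_independent_exchange (K : subringClosed F) (x x' : 'I_n -> F) :
  r != 0 -> r \is a mpolyOver n K ->
  (forall i, i != k -> x i = x' i) -> x k * x' k = r.@[x] ->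
  alg_independent K x -> alg_independent K x'.
Proof.
move=> r0 Kr xx' xk Kx q Kq qx'.
have Q0 : flip_poly q = 0.
  apply: Kx; last by rewrite /meval (mmap_flip q xx' xk) -/(meval x' q) qx' mulr0.
  rewrite rpred_sum // => m _; rewrite -mul_mpolyC rpredM //.
    by move/mpolyOverP: Kq => Kq; rewrite mpolyOverC Kq.
  rewrite rpredM ?rpredX //; apply/mpolyOverP => m'.
  by rewrite mcoeffX; case: (_ == _); rewrite ?rpred1 ?rpred0.
pose fr : {rmorphism F -> {fraction {mpoly F[n]}}} := (@tofrac {mpoly F[n]}) \o @mpolyC n F.
pose X (i : 'I_n) : {fraction {mpoly F[n]}} := @tofrac {mpoly F[n]} ('X_i : {mpoly F[n]}).
have rX : mmap fr X r = @tofrac {mpoly F[n]} r by apply: mmap_id_frac.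
(* The generic point that the substitution sends to the variables themselves. *)
pose Y (i : 'I_n) := if i == k then @tofrac {mpoly F[n]} r / X k else X i.
have YX i : i != k -> Y i = X i by rewrite /Y => /negbTE ->.
have Xk0 : X k != 0.
  rewrite /X tofrac_eq0; apply/eqP => /mpolyP /(_ U_(k)%MM).
  by rewrite mcoeffX eqxx mcoeff0 => /eqP; rewrite oner_eq0.
have YrX : Y k * X k = mmap fr Y r.
  by rewrite (mmap_free fr YX) rX /Y eqxx divfK.
have := mmap_flip q YX YrX; rewrite Q0 raddf0 mmap_id_frac => /esym/eqP.
rewrite mulf_eq0 expf_eq0 {1}/Y eqxx mulf_eq0 invr_eq0 (negbTE Xk0) orbF.
by rewrite !tofrac_eq0 (negbTE r0) andbF => /eqP.
Qed.

End ExchangeIndependence.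

Definition matrix_mutation (n : nat) (k : 'I_n) (B : 'M[int]_n) : 'M[int]_n :=
  \matrix_(i, j) (if (i == k) || (j == k) then - B i j
    else B i j + ((`|B i k| * B k j + B i k * `|B k j|) %/ 2)%Z).

Definition skew_for (n : nat) (d : 'I_n -> int) (B : 'M[int]_n) : Prop :=
  forall i j, d i * B i j = - (d j * B j i).

(** The division by 2 in the mutation rule is exact: the two terms are equal or
    opposite. *)
Lemma half_absE (x y : int) :
  ((`|x| * y + x * `|y|) %/ 2)%Z * 2 = `|x| * y + x * `|y|.
Proof.
apply: divzK; have [x0|x0] := lerP 0 x; have [y0|y0] := lerP 0 y;
  rewrite ?(ger0_norm x0) ?(ltr0_norm x0) ?(ger0_norm y0) ?(ltr0_norm y0).
- by apply/dvdzP; exists (x * y); ring.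
- by rewrite mulrN subrr dvdz0.
- by rewrite mulNr addNr dvdz0.
- by apply/dvdzP; exists (- (x * y)); ring.
Qed.

(** Unlike the sign condition on [B], skew-symmetrizability survives mutation:
    doubling removes the division by 2, and the identity then follows from
    [d a * B a b = - d b * B b a] and its version with absolute values. *)
Lemma skew_for_mutation (n : nat) (d : 'I_n -> int) (k : 'I_n) (B : 'M[int]_n) :
  (forall i, 0 < d i) -> skew_for d B -> skew_for d (matrix_mutation k B).
Proof.
move=> d0 skB i j; rewrite !mxE orbC; case: ifP => _.
  by rewrite !mulrN skB.
rewrite !mulrDr skB opprD; congr (_ + _).
apply: (mulIf (_ : 2 != 0 :> int)) => //.
have absB a b : d a * `|B a b| = d b * `|B b a|.
  by rewrite -(gtr0_norm (d0 a)) -(gtr0_norm (d0 b)) -!normrM skB normrN.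
rewrite mulNr -!mulrA !half_absE.
have -> : d i * (`|B i k| * B k j + B i k * `|B k j|) =
    (d i * `|B i k|) * B k j + (d i * B i k) * `|B k j| by ring.
rewrite absB skB.
have -> : d k * `|B k i| * B k j + - (d k * B k i) * `|B k j| =
    `|B k i| * (d k * B k j) - B k i * (d k * `|B k j|) by ring.
by rewrite absB skB; ring.
Qed.

Lemma matrix_mutationK (n : nat) (k : 'I_n) : involutive (@matrix_mutation n k).
Proof.
move=> B; apply/matrixP => i j; rewrite !mxE !eqxx !orbT /=.
case E : ((i == k) || (j == k)); first by rewrite opprK.
rewrite !normrN mulrN mulNr -opprD.
rewrite -[RHS]addr0 -addrA; congr (_ + _); apply: (mulIf (_ : 2 != 0 :> int)) => //.
have half_opp x y : ((- (`|x| * y + x * `|y|)) %/ 2)%Z * 2 = - (`|x| * y + x * `|y|).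
  by have := half_absE (- x) (- y); rewrite !normrN mulrN mulNr -opprD.
by rewrite mulrDl half_opp half_absE subrr mul0r.
Qed.

(** * Every reachable seed can be mutated in every direction *)

Lemma sf_mulDl (P : semifieldType) (p q r : P) :
  ((q \oplus r) * p = q * p \oplus r * p)%g.
Proof. by rewrite !(sf_mulC _ p) sf_mulDr. Qed.

Section MutationExists.
Context (P : semifieldType) (n : nat) (F : fieldType) (iota : P -> F).
Hypothesis hF : ambient_field n iota.
Implicit Types s : seed n iota.

Lemma cvar_neq0 s i : cvar s i != 0.
Proof.
apply/eqP => xi0; have [indep _] := seed_basis s.
have := indep 'X_i; rewrite mevalXU => /(_ _ xi0).
have K : 'X_i \is a mpolyOver n (fracZP iota).
  by apply/mpolyOverP => m; rewrite mcoeffX; case: (_ == _); rewrite ?rpred1 ?rpred0.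
move/(_ K)/mpolyP/(_ U_(i)%MM); rewrite mcoeffX eqxx mcoeff0 => /eqP.
by rewrite oner_eq0.
Qed.

(** The case [p = q] is where characteristic zero of the group ring enters. *)
Lemma iotaD_neq0 p q : iota p + iota q != 0.
Proof.
have [->|pq] := eqVneq p q.
  have := @iota_free _ _ _ _ hF [:: q] (fun=> 2) isT.
  rewrite big_seq1 -mulr2n => H; apply/eqP => /H /(_ q (mem_head _ _)).
  by [].
have := @iota_free _ _ _ _ hF [:: p; q] (fun=> 1).
rewrite /= inE pq => /(_ isT); rewrite big_cons big_seq1 => H.
by apply/eqP => /H /(_ p (mem_head _ _)).
Qed.

Lemma iota_fracZP p : iota p \in fracZP iota.
Proof. by apply: subfield_span_gen; exists p. Qed.

(** Otherwise the square of the entry would be negative. *)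
Lemma exmx_diag s k : exmx s k k = 0.
Proof.
by case: (seed_sign s k k) => [[]//|]; rewrite ltNge -expr2 sqr_ge0.
Qed.

Definition mexp_p s k : 'X_{1..n} :=
  [multinom if (0 < exmx s i k)%R then `|exmx s i k|%N else 0%N | i < n].

Definition mexp_m s k : 'X_{1..n} :=
  [multinom if (exmx s i k < 0)%R then `|exmx s i k|%N else 0%N | i < n].

(** The right-hand side of the exchange relation, as a polynomial in the current
    cluster; [exmx_diag] makes it free of the exchanged variable. *)
Definition exchange_poly s k : {mpoly F[n]} :=
  iota (pplus s k) *: 'X_[mexp_p s k] + iota (pminus s k) *: 'X_[mexp_m s k].

Lemma exchange_poly_eval s k :
  (exchange_poly s k).@[cvar s] =
  iota (pplus s k) * monp s k + iota (pminus s k) * monm s k.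
Proof.
rewrite mevalD !mevalZ !mevalX /monp /monm; congr (_ * _ + _ * _);
  rewrite [RHS]big_mkcond; apply: eq_bigr => i _; rewrite mnmE;
  by case: ifP => //; rewrite expr0.
Qed.

Lemma exchange_poly_neq0 s k : exchange_poly s k != 0.
Proof.
apply/eqP => /mpolyP /(_ (mexp_p s k)).
rewrite mcoeffD !mcoeffZ !mcoeffX eqxx mcoeff0 mulr1; case: (_ == _).
  by rewrite mulr1 => /eqP; rewrite (negbTE (iotaD_neq0 _ _)).
by rewrite mulr0 addr0 => /eqP; rewrite (negbTE (iota_neq0 hF _)).
Qed.

Lemma exchange_poly_over s k : exchange_poly s k \is a mpolyOver n (fracZP iota).
Proof.
by rewrite rpredD // -mul_mpolyC rpredM ?mpolyOverC ?iota_fracZP //;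
  apply/mpolyOverP => m; rewrite mcoeffX; case: (_ == _); rewrite ?rpred1 ?rpred0.
Qed.

Lemma exchange_poly_free s k m : m \in msupp (exchange_poly s k) -> m k = 0%N.
Proof.
move=> mr; have : m = mexp_p s k \/ m = mexp_m s k.
  move: mr; rewrite mcoeff_msupp mcoeffD !mcoeffZ !mcoeffX.
  case: (mexp_p s k =P m) => [<-|_]; first by left.
  case: (mexp_m s k =P m) => [<-|_]; first by right.
  by rewrite !mulr0 addr0 eqxx.
by case=> ->; rewrite mnmE exmx_diag ltxx.
Qed.

Definition mutated_cvar s (k i : 'I_n) : F :=
  if i == k then (exchange_poly s k).@[cvar s] / cvar s k else cvar s i.

Lemma mutated_cvar_neq s k i : i != k -> cvar s i = mutated_cvar s k i.
Proof. by rewrite /mutated_cvar => /negbTE ->. Qed.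

Lemma mutated_cvar_exchange s k :
  cvar s k * mutated_cvar s k k = (exchange_poly s k).@[cvar s].
Proof. by rewrite /mutated_cvar eqxx mulrC divfK ?cvar_neq0. Qed.

Lemma meval_adjoin (K : divringClosed F) (x : 'I_n -> F) (q : {mpoly F[n]}) :
  q \is a mpolyOver n K -> q.@[x] \in adjoin K x.
Proof.
move=> /mpolyOverP Kq; rewrite mevalE rpred_sum // => m _; rewrite rpredM //.
  by apply: subfield_span_gen; left.
by rewrite rpred_prod // => i _; rewrite rpredX //; apply: subfield_span_gen; right; exists i.
Qed.

(** The old cluster lies in the field generated by the new one, because the
    exchange polynomial takes the same value on both. *)
Lemma transcendence_basis_mutation s k :
  transcendence_basis (fracZP iota) (mutated_cvar s k).
Proof.
have [indep alg] := seed_basis s; split.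
  apply: (@alg_independent_exchange _ _ k (exchange_poly s k)) indep.
  - exact: exchange_poly_free.
  - exact: exchange_poly_neq0.
  - exact: exchange_poly_over.
  - by move=> i ik; apply: mutated_cvar_neq.
  - exact: mutated_cvar_exchange.
have sub : {subset adjoin (fracZP iota) (cvar s)
            <= adjoin (fracZP iota) (mutated_cvar s k)}.
  apply: subfield_span_sub => f [Kf|[i ->]]; first by apply: subfield_span_gen; left.
  have xi j : mutated_cvar s k j \in adjoin (fracZP iota) (mutated_cvar s k).
    by apply: subfield_span_gen; right; exists j.
  have [->|ik] := eqVneq i k; last by rewrite (mutated_cvar_neq _ ik); exact: xi.
  have r0 : (exchange_poly s k).@[cvar s] != 0.
    apply/eqP => /(indep _ (exchange_poly_over s k)) /eqP.
    by rewrite (negbTE (exchange_poly_neq0 s k)).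
  have -> : cvar s k = (exchange_poly s k).@[cvar s] / mutated_cvar s k k.
    by rewrite /mutated_cvar eqxx invfM invrK mulrA mulfV ?mul1r.
  rewrite rpred_div //.
  have -> : (exchange_poly s k).@[cvar s] = (exchange_poly s k).@[mutated_cvar s k].
    by apply: mmap_free; [exact: exchange_poly_free | exact: mutated_cvar_neq].
  exact/meval_adjoin/exchange_poly_over.
move=> f; have [q [Kq q0 qf]] := alg f; exists q; split=> //.
exact: polyOverS Kq.
Qed.

Definition mutated_ratio s (k i : 'I_n) : P :=
  (if i == k then pminus s k / pplus s k
   else if 0 <= exmx s k i then pplus s k ^+ `|exmx s k i|%N * coef_ratio s i
   else pminus s k ^- `|exmx s k i|%N * coef_ratio s i)%g.

(** Positivity of [d] forces [B i j] and [B j i] to have opposite signs. *)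
Lemma skew_seed_sign (d : 'I_n -> int) (B : 'M[int]_n) : (forall i, 0 < d i) ->
  skew_for d B -> forall i j, (B i j = 0 /\ B j i = 0) \/ B i j * B j i < 0.
Proof.
move=> d0 skB i j; have := skB i j.
have [->|Bij0 E] := eqVneq (B i j) 0.
  rewrite mulr0 => /eqP; rewrite eq_sym oppr_eq0 mulf_eq0 gt_eqF ?d0 //= => /eqP.
  by left.
right; rewrite -(pmulr_rlt0 _ (d0 j)).
have -> : d j * (B i j * B j i) = - (d i * B i j ^+ 2).
  by rewrite mulrCA -[d j * _]opprK -E; ring.
by rewrite oppr_lt0 mulr_gt0 ?d0 // exprn_even_gt0.
Qed.

(** The only obstruction to mutating a seed is the sign condition on the mutated
    matrix, which skew-symmetrizability guarantees. *)
Lemma mutation_exists s k (d : 'I_n -> int) :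
  (forall i, 0 < d i) -> skew_for d (exmx s) -> exists s', mutation k s s'.
Proof.
move=> d0 skB; pose r := mutated_ratio s k.
(* A prescribed ratio [r] has the normalized representative (r / (1 + r), 1 / (1 + r)). *)
have norm i : (r i / (1 \oplus r i)%g \oplus 1 / (1 \oplus r i))%g = 1%g :> P.
  by rewrite -sf_mulDl sf_addC mulgV.
have sgn := skew_seed_sign d0 (skew_for_mutation k d0 skB).
pose s' := Seed (transcendence_basis_mutation s k) norm sgn.
have ratio i : coef_ratio s' i = r i.
  by rewrite /coef_ratio /= !mul1g invgK mulgVK.
exists s'; split.
- by move=> i ik; rewrite (mutated_cvar_neq s ik).
- by rewrite -exchange_poly_eval -mutated_cvar_exchange.
- by rewrite ratio /r /mutated_ratio eqxx.
- by move=> i /negbTE ik Bki; rewrite ratio /r /mutated_ratio ik Bki.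
- move=> i /negbTE ik Bki; rewrite ratio /r /mutated_ratio ik.
  case: ifP => // Bki'; have -> : exmx s k i = 0 by apply/eqP; rewrite eq_le Bki.
  by rewrite !expg0 invg1.
- by move=> i j; rewrite mxE.
Qed.

Lemma mutation_exmx k s s' : mutation k s s' -> exmx s' = matrix_mutation k (exmx s).
Proof. by case=> _ _ _ _ _ h; apply/matrixP => i j; rewrite h mxE. Qed.

(** Both directions are needed, because the matrix of type [C_n] need not belong
    to the initial seed; the converse holds as mutation of matrices is an
    involution. *)
Lemma reachable_skew_for s0 s (d : 'I_n -> int) : (forall i, 0 < d i) ->
  reachable s0 s -> skew_for d (exmx s0) <-> skew_for d (exmx s).
Proof.
move=> d0; elim=> // s1 s2 k _ IH /mutation_exmx E.
rewrite IH; split=> sk; first by rewrite E; apply: skew_for_mutation.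
by rewrite -(matrix_mutationK k (exmx s1)) -E; apply: skew_for_mutation.
Qed.

End MutationExists.

(** The Cartan matrix of type [C_n] becomes symmetric when its last row is
    doubled. *)
Lemma type_C_skew (P : semifieldType) (n : nat) (F : fieldType) (iota : P -> F)
    (s0 : seed n iota) : type_C s0 ->
  exists2 d : 'I_n -> int, (forall i, 0 < d i) & skew_for d (exmx s0).
Proof.
case=> s [s0s [sigma E]].
pose c (i : 'I_n) : int := if i.+1 == n then 2 else 1.
pose d i := c (sigma^-1%g i).
have d0 i : 0 < d i by rewrite /d /c; case: ifP.
exists d => //; apply/(reachable_skew_for d0 s0s) => i j.
have absB : d i * `|exmx s i j| = d j * `|exmx s j i|.
  have [->//|ij] := eqVneq i j.
  have ab : sigma^-1%g i != sigma^-1%g j by rewrite (inj_eq perm_inj).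
  have ji : (j == i) = false by rewrite eq_sym (negbTE ij).
  have := E (sigma^-1%g i) (sigma^-1%g j); have := E (sigma^-1%g j) (sigma^-1%g i).
  rewrite !mxE !permKV (negbTE ij) ji /d /c.
  move: (sigma^-1%g i) (sigma^-1%g j) ab => a b ab.
  have ba : (b == a) = false by rewrite eq_sym (negbTE ab).
  rewrite (negbTE ab) ba; move: ab; rewrite -(inj_eq val_inj) /=.
  case: a b {ba} => [a la] [b lb] /= ab.
  by case: (a.+1 =P b); case: (b.+1 =P a); case: (a.+1 =P n); case: (b.+1 =P n) => /=; lia.
have := seed_sign s i j; case=> [[-> ->]|]; first by rewrite !mulr0 oppr0.
move: absB; have [bij|bij|->] := ltrgt0P (exmx s i j); last by rewrite mul0r ltxx.
  rewrite pmulr_rlt0 // => absB bji; by rewrite absB ltr0_norm // mulrN.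
rewrite nmulr_rlt0 // => absB bji; rewrite -[LHS]opprK -mulrN absB.
by rewrite gtr0_norm.
Qed.

(** * Combinatorics of the centrally symmetric polygon *)

Section Polygon.
Context (n : nat).
Implicit Types (a b c d u v : vertex n) (e : {set vertex n}) (i j : 'I_n.+1).

Lemma val_vertexB a b :
  (b - a : vertex n) = (if (a <= b)%N then (b - a)%N else (b + n.*2.+2 - a)%N) :> nat.
Proof.
have ha := ltn_ord a; have hb := ltn_ord b; rewrite /= modnDmr.
case: leqP => ab; last by rewrite modn_small; lia.
by rewrite (_ : (b + _ = b - a + n.*2.+2)%N) ?modnDr ?modn_small //; lia.
Qed.

(** Positions are compared through the representatives [0, ..., 2 n + 1], so that
    arithmetic modulo [2 n + 2] becomes a case analysis. *)
Lemma val_bar a : bar a = (if (a <= n)%N then (a + n.+1)%N else (a - n.+1)%N) :> nat.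
Proof.
have ha := ltn_ord a; rewrite /bar Zp_nat /= modnDmr.
case: leqP => an; first by rewrite modn_small; lia.
by rewrite (_ : (a + n.+1 = a - n.+1 + n.*2.+2)%N) ?modnDr ?modn_small //; lia.
Qed.

Lemma val_vertexS a :
  (a + 1 : vertex n) = (if (a == n.*2.+1 :> nat) then 0%N else a.+1) :> nat.
Proof.
have ha := ltn_ord a; rewrite /= (@modn_small 1) // addn1.
case: eqP => [->|ne]; first by rewrite modnn.
by rewrite modn_small //; lia.
Qed.

Lemma barK : involutive (@bar n).
Proof.
move=> a; apply: ord_inj; have ha := ltn_ord a.
by rewrite !val_bar; case: (leqP a n) => an; case: leqP => ?; lia.
Qed.

Lemma bar_inj : injective (@bar n). Proof. exact: inv_inj barK. Qed.

Lemma val_vtx i : vtx i = i :> nat.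
Proof. by rewrite /vtx inordK //; have := ltn_ord i; lia. Qed.

Lemma vtx_or_bar v : exists i, v = vtx i \/ v = bar (vtx i).
Proof.
have hv := ltn_ord v; case: (leqP v n) => vn.
  by exists (inord v); left; apply: ord_inj; rewrite val_vtx inordK.
have hi : (v - n.+1 < n.+1)%N by lia.
by exists (Ordinal hi); right; apply: ord_inj; rewrite val_bar val_vtx /=; case: leqP; lia.
Qed.

Lemma pair_eq a b c d : [set a; b] = [set c; d] ->
  (a = c /\ b = d) \/ (a = d /\ b = c).
Proof.
move/setP => E; have := E a; have := E b; have := E c; have := E d.
rewrite !inE !eqxx !orbT /=.
by do 4![case: eqP => ?]; subst; auto; do ?[case: eqP => ?]; subst; auto.
Qed.

Lemma Theta_pair a b : Theta [set a; b] = [set bar a; bar b].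
Proof. by rewrite /Theta imsetU1 imset_set1. Qed.

Lemma Theta_orbit_eq e e' : Theta_orbit e = Theta_orbit e' -> e = e' \/ e = Theta e'.
Proof.
move/setP/(_ e); rewrite !inE eqxx /= => /esym /orP[] /eqP; by auto.
Qed.

Lemma orbit_ofC a b : orbit_of a b = orbit_of b a.
Proof. by rewrite /orbit_of setUC. Qed.

Lemma orbit_of_bar a b : orbit_of (bar a) (bar b) = orbit_of a b.
Proof.
by rewrite /orbit_of -Theta_pair /Theta_orbit !Theta_pair !barK setUC.
Qed.

Lemma orbit_of_barr a b : orbit_of a (bar b) = orbit_of (bar a) b.
Proof. by rewrite -orbit_of_bar barK. Qed.

Lemma is_side_pair a b : is_side [set a; b] = (b == a + 1) || (a == b + 1).
Proof.
apply/existsP/orP => [[c /eqP /pair_eq [[-> ->]|[-> ->]]]|[] /eqP ->].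
- by left.
- by right.
- by exists a.
- by exists b; rewrite setUC.
Qed.

Lemma barD1 a : bar (a + 1) = bar a + 1.
Proof. by rewrite /bar addrAC. Qed.

Lemma is_side_Theta a b : is_side [set bar a; bar b] = is_side [set a; b].
Proof. by rewrite !is_side_pair -!barD1 !(inj_eq bar_inj). Qed.

Lemma side_orbit_pair a b : (orbit_of a b \in side_orbits n) = is_side [set a; b].
Proof.
apply/imsetP/idP => [[e]|sab]; last by exists [set a; b].
case/existsP => c /eqP -> /Theta_orbit_eq [->|]; first by apply/existsP; exists c.
by rewrite Theta_pair => ->; rewrite is_side_Theta; apply/existsP; exists c.
Qed.

Lemma diagonal_orbit_pair a b : a != b -> ~~ is_side [set a; b] ->
  orbit_of a b \in diagonal_orbits n.
Proof.
move=> ab nside; apply/imsetP; exists [set a; b] => //.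
by rewrite unfold_in /is_diagonal cards2 ab.
Qed.

Lemma diagonal_pair e : is_diagonal e ->
  exists a b, [/\ a != b, e = [set a; b] & ~~ is_side [set a; b]].
Proof.
by case/andP => /cards2P [a [b [ab ->]]] nside; exists a, b.
Qed.

(** The case distinction in the list of minors is exhaustive. *)
Lemma orbit_pair_cases a b : a != b ->
  (exists i j, (i < j)%N /\ orbit_of a b = orbit_of (vtx i) (vtx j)) \/
  (exists i j, (i <= j)%N /\ orbit_of a b = orbit_of (vtx i) (bar (vtx j))).
Proof.
have vv i j : vtx i != vtx j -> exists i' j', (i' < j')%N /\
    orbit_of (vtx i) (vtx j) = orbit_of (vtx i') (vtx j').
  move=> ij; have : i != j by apply: contraNneq ij => ->.
  rewrite -(inj_eq val_inj) neq_ltn => /orP[ij'|ij'].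
    by exists i, j.
  by exists j, i; rewrite orbit_ofC.
have vb i j : exists i' j', (i' <= j')%N /\
    orbit_of (vtx i) (bar (vtx j)) = orbit_of (vtx i') (bar (vtx j')).
  have [ij|/ltnW ij] := leqP i j; first by exists i, j.
  by exists j, i; rewrite orbit_of_barr orbit_ofC.
have [i [->|->]] := vtx_or_bar a; have [j [->|->]] := vtx_or_bar b.
- by move/vv; left.
- by move=> _; right.
- by move=> _; rewrite -orbit_of_barr; right.
- by rewrite (inj_eq bar_inj) orbit_of_bar => /vv; left.
Qed.

Lemma ccw3 a b c : ccw [:: a; b; c] =
  [&& (0 < (b - a)%R)%N & ((b - a)%R < (c - a)%R)%N].
Proof.
rewrite -[LHS]/[&& ((a - a)%R < (b - a)%R)%N, ((b - a)%R < (c - a)%R)%N & true].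
by rewrite val_vertexB leqnn subnn andbT.
Qed.

Lemma ccw4 a b c d : ccw [:: a; b; c; d] =
  [&& (0 < (b - a)%R)%N, ((b - a)%R < (c - a)%R)%N & ((c - a)%R < (d - a)%R)%N].
Proof.
rewrite -[LHS]/[&& ((a - a)%R < (b - a)%R)%N, ((b - a)%R < (c - a)%R)%N,
      ((c - a)%R < (d - a)%R)%N & true].
by rewrite val_vertexB leqnn subnn andbT.
Qed.

Lemma ccw5 a b c d u : ccw [:: a; b; c; d; u] =
  [&& (0 < (b - a)%R)%N, ((b - a)%R < (c - a)%R)%N,
      ((c - a)%R < (d - a)%R)%N & ((d - a)%R < (u - a)%R)%N].
Proof.
rewrite -[LHS]/[&& ((a - a)%R < (b - a)%R)%N, ((b - a)%R < (c - a)%R)%N,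
      ((c - a)%R < (d - a)%R)%N, ((d - a)%R < (u - a)%R)%N & true].
by rewrite val_vertexB leqnn subnn andbT.
Qed.

Lemma crossing_pair a b c d : (a < b)%N -> (a < c < b)%N -> ((d < a) || (b < d))%N ->
  crossing [set a; b] [set c; d].
Proof.
have ha := ltn_ord a; have hb := ltn_ord b; have hc := ltn_ord c; have hd := ltn_ord d.
move=> ab acb dab; apply/existsP; exists a; apply/existsP; exists c.
apply/existsP; exists b; apply/existsP; exists d; rewrite !eqxx ccw4 !val_vertexB.
by case: (leqP a c); case: (leqP a b); case: (leqP a d) => /=; lia.
Qed.

Lemma crossing_pairP a b c d : crossing [set a; b] [set c; d] -> (a < b)%N ->
  ((a < c < b) && ((d < a) || (b < d)) || (a < d < b) && ((c < a) || (b < c)))%N.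
Proof.
have ha := ltn_ord a; have hb := ltn_ord b; have hc := ltn_ord c; have hd := ltn_ord d.
case/existsP => p /existsP [q /existsP [r /existsP [s]]].
have hp := ltn_ord p; have hq := ltn_ord q; have hr := ltn_ord r; have hs := ltn_ord s.
case/and3P => /eqP /pair_eq E1 /eqP /pair_eq E2; rewrite ccw4 !val_vertexB.
case: E1 => -[? ?]; case: E2 => -[? ?]; subst;
by case: (leqP p q); case: (leqP p r); case: (leqP p s) => /=; lia.
Qed.

(** For [k = n + 1] the two chords coincide: both are the diameter through 0. *)
Definition fan : {set {set vertex n}} :=
  [set e | [exists k : vertex n, (1 < k <= n.+1)%N &&
    ((e == [set 0; k]) || (e == [set bar 0; bar k]))]].

Lemma fanP e : reflect (exists k : vertex n, (1 < k <= n.+1)%N /\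
    (e = [set 0; k] \/ e = [set bar 0; bar k])) (e \in fan).
Proof.
rewrite inE; apply: (iffP existsP) => -[k]; first by
  case/andP => kn /orP[] /eqP ->; exists k; auto.
by case=> kn [] ->; exists k; rewrite kn eqxx ?orbT.
Qed.

Lemma val_bar0 : bar (0 : vertex n) = n.+1 :> nat. Proof. by rewrite val_bar. Qed.

Lemma fan_invariant : Theta_invariant fan.
Proof.
have sub e : e \in fan -> Theta e \in fan.
  by case/fanP => k [kn [] ->]; apply/fanP; exists k; split=> //;
    rewrite Theta_pair ?barK; auto.
apply/eqP/setP => e; apply/imsetP/idP => [[e' e'T ->]|eT]; first exact: sub.
exists (Theta e); first exact: sub.
by rewrite /Theta -imset_comp (eq_imset _ barK) imset_id.
Qed.

Lemma val_vertex0 : (0 : vertex n) = 0%N :> nat. Proof. by []. Qed.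

Definition in_fan (p q : nat) : bool :=
  ((p == 0) && (1 < q <= n.+1) || (p == n.+1) && (n.+2 < q))%N.

Lemma fan_pair u v : in_fan u v -> [set u; v] \in fan.
Proof.
have hv := ltn_ord v; move=> huv; apply/fanP.
case/orP: huv => /andP[/eqP u0 hv'].
  by exists v; split=> //; left; congr [set _; _]; apply: ord_inj.
exists (bar v); rewrite val_bar; split; first by case: (leqP v n); lia.
by right; rewrite barK; congr [set _; _]; apply: ord_inj; rewrite val_bar0.
Qed.

Lemma fan_pairP e : e \in fan ->
  exists u v, [/\ e = [set u; v], (u < v)%N & in_fan u v].
Proof.
case/fanP => k [kn [->|->]].
  by exists 0, k; rewrite /in_fan val_vertex0 kn; split=> //; case/andP: kn => /ltnW.
have hk := ltn_ord k.
have [kn1|kn1] := leqP k n.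
  exists (bar 0), (bar k); rewrite /in_fan val_bar0 val_bar ifT //; split=> //; lia.
exists 0, (bar 0); rewrite setUC; split; first 1 last.
- by rewrite val_bar0.
- by rewrite /in_fan val_bar0 val_vertex0; lia.
by congr [set _; _]; apply: ord_inj; rewrite val_bar ifF ?val_vertex0; lia.
Qed.

Hypothesis n2 : (1 < n)%N.

Lemma is_diagonal_pair u v : (u < v)%N ->
  is_diagonal [set u; v] = ((u.+1 != v) && ((u != 0 :> nat) || (v != n.*2.+1 :> nat))).
Proof.
have hu := ltn_ord u; have hv := ltn_ord v; move=> uv.
rewrite /is_diagonal cards2 is_side_pair.
have -> : u != v by apply: contraTneq uv => ->; rewrite ltnn.
rewrite -!(inj_eq (@ord_inj n.*2.+2)) !val_vertexS.
by case: (u =P n.*2.+1 :> nat); case: (v =P n.*2.+1 :> nat); lia.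
Qed.

(** Maximality: a diagonal [[u, v]] outside the fan is crossed by a member of the
    fan, ending next to [u] or [v] when [u] and [v] lie in the same half of the
    polygon, and by the diameter otherwise. *)
Lemma fan_triangulation : triangulation fan.
Proof.
apply/maxsetP; split=> [|S /andP[/forall_inP Sd /forall_inP Snc] fanS].
  apply/andP; split; apply/forall_inP => e /fan_pairP [u [v [-> uv fuv]]].
    have hv := ltn_ord v; rewrite is_diagonal_pair //; move: fuv; rewrite /in_fan; lia.
  apply/forall_inP => _ /fan_pairP [u' [v' [-> uv' fuv']]].
  by apply/negP => /crossing_pairP /(_ uv); move: fuv fuv'; rewrite /in_fan; lia.
apply/eqP; rewrite eqEsubset fanS andbT; apply/subsetP => e eS.
have [a0 [b0 [ab0 Ee _]]] := diagonal_pair (Sd e eS).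
have [u [v [{}Ee uv]]] : exists u v, e = [set u; v] /\ (u < v)%N.
  have : (a0 != b0 :> nat) by rewrite (inj_eq val_inj).
  rewrite neq_ltn => /orP[ab|ba]; first by exists a0, b0.
  by exists b0, a0; rewrite setUC.
have hu := ltn_ord u; have hv := ltn_ord v.
have := Sd e eS; rewrite Ee is_diagonal_pair // => duv.
apply: fan_pair; apply: contraT => nf.
have noX (p q : vertex n) : in_fan p q -> ~~ crossing e [set p; q].
  by move/fan_pair/(subsetP fanS) => pqS; apply: (forall_inP (Snc e eS)).
pose w : vertex n := inord u.+1.
pose h : vertex n := inord n.+1.
pose w' : vertex n := inord v.+1.
have wE : w = u.+1 :> nat by rewrite inordK //; lia.
have hE : h = n.+1 :> nat by rewrite inordK //; lia.
have [u0|u0] := eqVneq (u : nat) 0%N.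
  (* Here [0 = u < h < v], and [[h, v + 1]] crosses [[u, v]]. *)
  have w'E : w' = v.+1 :> nat by rewrite inordK //; move: nf duv; rewrite /in_fan u0; lia.
  have := noX h w'; rewrite Ee crossing_pair ?hE ?w'E ?u0; last 3 first.
  - by lia.
  - by move: nf; rewrite /in_fan u0; lia.
  - by lia.
  by move=> H; apply: H; move: nf; rewrite /in_fan u0; lia.
have noX' (p q : vertex n) : in_fan p q -> ~~ crossing e [set q; p].
  by rewrite setUC; apply: noX.
have [vh|vh] := leqP v n.+1.
  have := noX' 0 w; rewrite Ee crossing_pair ?wE ?val_vertex0; last 3 first.
  - by lia.
  - by lia.
  - by lia.
  by move=> H; apply: H; rewrite /in_fan; lia.
have [uh|uh] := ltnP u n.+1.
  have := noX' 0 h; rewrite Ee crossing_pair ?hE ?val_vertex0; last 3 first.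
  - by lia.
  - by lia.
  - by lia.
  by move=> H; apply: H; rewrite /in_fan; lia.
have := noX' h w; rewrite Ee crossing_pair ?hE ?wE; last 3 first.
- by lia.
- by lia.
- by move: nf; rewrite /in_fan; lia.
by move=> H; apply: H; move: nf; rewrite /in_fan; lia.
Qed.

End Polygon.

(** * Labels in the ambient field *)

Section Labels.
Context (n : nat) (F : fieldType) (iota : tropC n -> F).
Context (x : {set {set vertex n}} -> F) (s0 : seed n iota).
Hypotheses (n2 : (1 < n)%N) (hF : ambient_field n iota) (hA : is_Acirc x s0).
Implicit Types (a b c d u v : vertex n) (i j k l : 'I_n.+1).

Local Notation lab := (labeled iota x).
Local Notation U i j := (lab (orbit_of (vtx i) (vtx j))).
Local Notation V i j := (lab (orbit_of (vtx i) (bar (vtx j)))).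

Lemma iota1 : iota 1%g = 1.
Proof.
apply: (mulfI (iota_neq0 hF 1%g)).
by rewrite -(iota_mul hF) mulg1 mulr1.
Qed.

Lemma iota_prod (m : seq {set {set vertex n}}) :
  iota (\prod_(o <- m) side_coef o)%g = \prod_(o <- m) iota (side_coef o).
Proof. by apply: (big_morph iota); [exact: iota_mul hF | exact: iota1]. Qed.

Lemma side_coef_nonside o : o \notin side_orbits n -> side_coef o = 1%g.
Proof.
move=> no; apply/ffunP => j; rewrite !ffunE.
by case: eqP => // jo; move: no; rewrite -jo (valP j).
Qed.

(** A side contributes its coefficient and the variable 1; a diagonal contributes
    its variable and the coefficient 1. *)
Lemma iota_side_coef o : iota (side_coef o) * side_var x o = lab o.
Proof.
rewrite /side_var /labeled; case: ifP => [|/negbT] so; first by rewrite mulr1.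
by rewrite side_coef_nonside // iota1 mul1r.
Qed.

Lemma term_labeled (m : seq {set {set vertex n}}) :
  iota (term x m).1 * (term x m).2 = \prod_(o <- m) lab o.
Proof.
by rewrite /term /= iota_prod -big_split; apply: eq_bigr => o _; exact: iota_side_coef.
Qed.

(** With sides labeled by their coefficients, the exchange relations lose their
    coefficients. *)
Lemma labeled_exchange o o' m m' : polygon_exchange o o' m m' ->
  o \notin side_orbits n -> o' \notin side_orbits n ->
  lab o * lab o' = \prod_(o <- m) lab o + \prod_(o <- m') lab o.
Proof.
move=> ex no no'; have [z [z' [t [t' [[s [s' [k [_ mut zz' tE t'E]]]] [E1 E2]]]]]] :=
  Acirc_exchange_all hA ex.
have zt : z * z' = iota t.1 * t.2 + iota t'.1 * t'.2.
  by case: zz' => -> ->; rewrite tE t'E /= (mut_exchange mut).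
have -> : lab o * lab o' = z * z'.
  rewrite /labeled (negbTE no) (negbTE no').
  by case: E1 => -[-> ->] //; rewrite mulrC.
by rewrite zt -!term_labeled; case: E2 => -[-> ->] //; rewrite addrC.
Qed.

(** Mutating the seed at [k] exhibits its coefficients at [k] in an exchange
    relation, where they are products of sides. *)
Lemma seed_coefficients_sides (s : seed n iota) (k : 'I_n) :
  reachable s0 s -> exists m m',
  (pplus s k = (\prod_(o <- m) side_coef o)%g /\
   pminus s k = (\prod_(o <- m') side_coef o)%g).
Proof.
move=> s0s; have [d d0 skd] := type_C_skew (Acirc_type hA).
have [s' mut] := mutation_exists hF k d0 ((reachable_skew_for d0 s0s).1 skd).
have [] := @Acirc_exchange _ _ _ _ _ hA (cvar s k) (cvar s' k)
  (pplus s k, monp s k) (pminus s k, monm s k); first by exists s, s', k.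
move=> o [o' [m [m' [_ [_]]]]] [] [] -> _ -> _; first by exists m, m'.
by exists m', m.
Qed.

Definition is_label (y : F) : Prop := exists a b, a != b /\ y = lab (orbit_of a b).

Lemma label_orbit a b : a != b -> is_label (lab (orbit_of a b)).
Proof. by exists a, b. Qed.

Lemma vertexS_neq a : a != a + 1.
Proof.
by rewrite -(inj_eq (@ord_inj n.*2.+2)) val_vertexS; case: ifP; lia.
Qed.

Lemma side_orbitsP o : o \in side_orbits n -> exists a, o = orbit_of a (a + 1).
Proof. by case/imsetP => e /existsP [a /eqP ->] ->; exists a. Qed.

Lemma cluster_algebra_sub_labels :
  {subset cluster_algebra s0 <= subring_span is_label}.
Proof.
move=> y0 y0A; apply: (@subring_span_ind _ _ (fun y => y \in subring_span is_label))
  y0A.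
- exact: rpred1.
- by move=> y z; apply: rpredB.
- by move=> y z; apply: rpredM.
have gen m : iota (\prod_(o <- m) side_coef o)%g \in subring_span is_label.
  rewrite iota_prod rpred_prod // => o _.
  have [so|/side_coef_nonside ->] := boolP (o \in side_orbits n); last first.
    by rewrite iota1 rpred1.
  have -> : iota (side_coef o) = lab o by rewrite /labeled so.
  case/side_orbitsP: so => a ->; apply/subring_span_gen/label_orbit.
  exact: vertexS_neq.
move=> y [/(Acirc_label hA) [o /imsetP [e /diagonal_pair [a [b [ab -> nside]]] ->] ->]|].
  apply: subring_span_gen; exists a, b; split=> //.
  by rewrite /labeled side_orbit_pair (negbTE nside).
by case=> s [k [s0s]]; have [m [m' [-> ->]]] := seed_coefficients_sides k s0s; case=> ->.
Qed.

Lemma ccw_after (a b c d : vertex n) : c = b + 1 -> b = a + 1 -> d = bar a ->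
  ccw [:: a; b; c; d].
Proof.
move=> cE bE dE; rewrite ccw4.
have -> : b - a = (0 + 1 : vertex n) by rewrite bE add0r addrAC subrr add0r.
have -> : c - a = (0 + 1 + 1 : vertex n) by rewrite cE bE; ring.
have -> : d - a = bar (0 : vertex n) by rewrite dE /bar; ring.
have n1 : (1 == n.*2.+1)%N = false by lia.
by rewrite !val_vertexS val_bar0 val_vertex0 (_ : (0 == n.*2.+1)%N = false) ?n1 /=; lia.
Qed.

(** A diagonal is a cluster variable.  For a side [[c, c + 1]], take the second
    exchange relation with [a = c - 1], [b = c] and third vertex [c + 1]: the
    monomial [x_(a, bar a) x_(b, b + 1)] has coefficient [p_(c, c + 1)], because
    [[a, bar a]] is a diagonal. *)
Lemma label_cluster_algebra y : is_label y -> y \in cluster_algebra s0.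
Proof.
case=> a [b [ab ->]]; rewrite /labeled side_orbit_pair.
case: ifP => [|/negbT nside]; last first.
  apply: subring_span_gen; left; apply/(Acirc_label hA).
  by exists (orbit_of a b) => //; exact: diagonal_orbit_pair.
suff side c : iota (side_coef (orbit_of c (c + 1))) \in cluster_algebra s0.
  by rewrite is_side_pair => /orP[] /eqP ->; rewrite // orbit_ofC.
have cE : c = (c - 1) + 1 by rewrite subrK.
have ex := polygon_exchange2 (ccw_after (erefl _) cE (erefl _)).
have [z [z' [t [t' [[s [s' [k [s0s mut zz' tE t'E]]]] [_ E2]]]]]] :=
  Acirc_exchange_all hA ex.
have diam (u : vertex n) : side_coef (orbit_of u (bar u)) = 1%g.
  apply: side_coef_nonside; rewrite side_orbit_pair is_side_pair.
  have hu := ltn_ord u; rewrite -!(inj_eq (@ord_inj n.*2.+2)) !val_vertexS val_bar.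
  by case: (leqP u n) => ?; do ![case: ifP => ?]; lia.
have -> : side_coef (orbit_of c (c + 1)) =
    (term x [:: orbit_of (c - 1) (bar (c - 1)); orbit_of c (c + 1)]).1.
  by rewrite /term /= big_cons big_seq1 diam mul1g.
have coefs : iota t.1 \in cluster_algebra s0 /\ iota t'.1 \in cluster_algebra s0.
  by split; apply: subring_span_gen; right; exists s, k; split=> //; rewrite ?tE ?t'E; auto.
by case: E2 => -[E E']; rewrite E E' in coefs; case: coefs.
Qed.

Lemma labeled_neq0 a b : a != b -> lab (orbit_of a b) != 0.
Proof.
move=> ab; rewrite /labeled side_orbit_pair; case: ifP => [_|/negbT nside].
  exact: iota_neq0 hF _.
have /(Acirc_label hA) [s [i [_ ->]]] : exists2 o, o \in diagonal_orbits n &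
    x (orbit_of a b) = x o.
  by exists (orbit_of a b) => //; apply: diagonal_orbit_pair.
exact: cvar_neq0.
Qed.

Lemma side_orbit_vtx i j : (i < j)%N ->
  (orbit_of (vtx i) (vtx j) \in side_orbits n) = (i.+1 == j :> nat).
Proof.
have hi := ltn_ord i; have hj := ltn_ord j; move=> ij.
rewrite side_orbit_pair is_side_pair -!(inj_eq (@ord_inj n.*2.+2)) !val_vertexS !val_vtx.
by do ![case: ifP => ?]; lia.
Qed.

Lemma side_orbit_vtx_bar i j : (i <= j)%N ->
  (orbit_of (vtx i) (bar (vtx j)) \in side_orbits n) = (i == 0 :> nat) && (j == n :> nat).
Proof.
have hi := ltn_ord i; have hj := ltn_ord j; move=> ij.
rewrite side_orbit_pair is_side_pair -!(inj_eq (@ord_inj n.*2.+2)) !val_vertexS.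
rewrite val_bar !val_vtx.
by rewrite ifT; [do ![case: ifP => ?]; lia | lia].
Qed.

Lemma label_barC i j : V i j = V j i.
Proof. by rewrite orbit_of_barr orbit_ofC. Qed.

Lemma bar_vtxB i j : (bar (vtx j) - vtx i : vertex n) = (n.+1 + j - i)%N :> nat.
Proof.
have hi := ltn_ord i; have hj := ltn_ord j.
rewrite val_vertexB val_bar !val_vtx ifT ?ifT; lia.
Qed.

Lemma vtxB i j : (i <= j)%N -> (vtx j - vtx i : vertex n) = (j - i)%N :> nat.
Proof. by move=> ij; rewrite val_vertexB !val_vtx ij. Qed.

Lemma label_ptolemy i j k l : (i < j)%N -> (j < k)%N -> (k < l)%N ->
  U i k * U j l = U i j * U k l + U i l * U j k.
Proof.
move=> ij jk kl; have hl := ltn_ord l.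
have := @labeled_exchange _ _ _ _ (@polygon_exchange1 n (vtx i) (vtx j) (vtx k) (vtx l) _).
rewrite !big_cons !big_nil !mulr1; apply.
- by rewrite ccw5 bar_vtxB !vtxB; lia.
- by rewrite side_orbit_vtx; lia.
- by rewrite side_orbit_vtx; lia.
Qed.

Lemma label_ptolemy_bar i j k : (i < j)%N -> (j < k)%N ->
  U i k * V i j = U i j * V i k + V i i * U j k.
Proof.
move=> ij jk; have hk := ltn_ord k.
have := @labeled_exchange _ _ _ _ (@polygon_exchange2 n (vtx i) (vtx j) (vtx k) _).
rewrite !big_cons !big_nil !mulr1; apply.
- by rewrite ccw4 bar_vtxB !vtxB; lia.
- by rewrite side_orbit_vtx; lia.
- by rewrite side_orbit_vtx_bar; lia.
Qed.

Lemma label_ptolemy_bar0 i j : (0 < i)%N -> (i < j)%N ->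
  V i 0 * V i j = U i j * U 0 i + V i i * V j 0.
Proof.
move=> i0 ij; have hj := ltn_ord j.
have := @labeled_exchange _ _ _ _
  (@polygon_exchange2 n (vtx i) (vtx j) (bar (vtx 0)) _).
rewrite !big_cons !big_nil !mulr1 barK (orbit_ofC (vtx i) (vtx 0)); apply.
- by rewrite ccw4 !bar_vtxB !vtxB /=; lia.
- by rewrite orbit_of_barr orbit_ofC side_orbit_vtx_bar /=; lia.
- by rewrite side_orbit_vtx_bar; lia.
Qed.

Lemma label_diameters i j : (i < j)%N ->
  V i i * V j j = U i j ^+ 2 + V i j ^+ 2.
Proof.
move=> ij; have hj := ltn_ord j.
have := @labeled_exchange _ _ _ _ (@polygon_exchange3 n (vtx i) (vtx j) _).
rewrite !big_cons !big_nil !mulr1 !expr2; apply.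
- by rewrite ccw3 !bar_vtxB !vtxB; lia.
- by rewrite side_orbit_vtx_bar; lia.
- by rewrite side_orbit_vtx_bar; lia.
Qed.

End Labels.

(** * Ptolemy systems and their fans *)

(** [U i j] stands for the orbit of [[i, j]] with [i < j], and [V i j] for the
    orbit of [[i, bar j]].  [ptolemyVV] is the second exchange relation with
    third vertex [bar 0]. *)
Record ptolemy_system (n : nat) (E : comNzRingType)
    (U V : 'I_n.+1 -> 'I_n.+1 -> E) : Prop := {
  ptolemyUU : forall i j k l : 'I_n.+1, (i < j)%N -> (j < k)%N -> (k < l)%N ->
    U i k * U j l = U i j * U k l + U i l * U j k;
  ptolemyUV : forall i j k : 'I_n.+1, (i < j)%N -> (j < k)%N ->
    U i k * V i j = U i j * V i k + V i i * U j k;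
  ptolemyVV : forall i j : 'I_n.+1, (0 < i)%N -> (i < j)%N ->
    V i ord0 * V i j = U i j * U ord0 i + V i i * V j ord0;
  ptolemy_diameters : forall i j : 'I_n.+1, (i < j)%N ->
    V i i * V j j = U i j ^+ 2 + V i j ^+ 2;
  ptolemyVC : forall i j, V i j = V j i
}.

Lemma ptolemy_pair (n : nat) (E E' : comNzRingType)
    (U V : 'I_n.+1 -> 'I_n.+1 -> E) (U' V' : 'I_n.+1 -> 'I_n.+1 -> E') :
  ptolemy_system U V -> ptolemy_system U' V' ->
  ptolemy_system (fun i j => (U i j, U' i j) : (E * E')%type)
    (fun i j => (V i j, V' i j) : (E * E')%type).
Proof.
(* Operations on pairs are componentwise. *)
move=> [p1 p2 p3 p4 p5] [q1 q2 q3 q4 q5]; split=> *; congr pair => /=; by auto.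
Qed.

Section FanGenerates.
Context (n : nat) (E : comNzRingType) (U V : 'I_n.+1 -> 'I_n.+1 -> E).
Context (W nz : E -> Prop).
Hypothesis UV : ptolemy_system U V.
Hypotheses (WD : forall e e', W e -> W e' -> W (e + e'))
  (WM : forall e e', W e -> W e' -> W (e * e'))
  (Wdiv : forall e e', nz e -> W e -> W (e * e') -> W e').
Hypotheses (nzU : forall i j : 'I_n.+1, (i < j)%N -> nz (U i j))
  (nzV : forall i j : 'I_n.+1, nz (V i j)).
Hypotheses (W0 : forall j : 'I_n.+1, (0 < j)%N -> W (U ord0 j))
  (WV00 : W (V ord0 ord0)) (WV0n : W (V ord0 ord_max))
  (WUS : forall i j : 'I_n.+1, j = i.+1 :> nat -> W (U i j)).

(** Each label is the only unknown in a relation whose other terms are known: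
    [U i (j + 1)] in the relation of [0, i, j, j + 1]; then [V 0 j] in that of
    [0, j, n, bar 0]; then the diameters [V i i] from [V 0 0]; and finally
    [V i j] in that of [i, j, bar 0, bar i].  The predicate [W] is used for
    the pairs of fractions below. *)
Lemma fan_generates :
  (forall i j : 'I_n.+1, (i < j)%N -> W (U i j)) /\
  (forall i j : 'I_n.+1, W (V i j)).
Proof.
have WU (i j : 'I_n.+1) : (i < j)%N -> W (U i j).
  have [m] := ubnP j; elim: m => // m IH in j *; rewrite ltnS => jm ij.
  have [i0|i0] := posnP i.
    by rewrite (_ : i = ord0); [apply: W0; lia | apply: ord_inj].
  have [|ne] := eqVneq (j : nat) i.+1; first exact: WUS.
  have hj := ltn_ord j; have hk : (j.-1 < n.+1)%N by lia.
  pose k := Ordinal hk; have jk : j = k.+1 :> nat by rewrite /=; lia.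
  have ik : (i < k)%N by lia.
  have k0 : (0 < k)%N by lia.
  apply: (Wdiv (nzU (_ : ord0 < k)%N)) => //; first exact: W0.
  rewrite (ptolemyUU UV) ?jk //; apply: WD; apply: WM; try exact: W0.
  - exact: WUS.
  - by apply: W0; lia.
  - by apply: IH => //; lia.
have WV0 (j : 'I_n.+1) : W (V ord0 j).
  have hj := ltn_ord j; have [j0|j0] := posnP j.
    by rewrite (_ : j = ord0) //; apply: ord_inj.
  have [jn|jn] := eqVneq (j : nat) n.
    by rewrite (_ : j = ord_max) //; apply: ord_inj.
  have jmax : (j < @ord_max n)%N by rewrite /=; lia.
  have max0 : (0 < @ord_max n)%N by rewrite /=; lia.
  apply: (Wdiv (nzU (_ : ord0 < @ord_max n)%N)) => //; first exact: W0.
  by rewrite (ptolemyUV UV) //; apply: WD; apply: WM; auto.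
have WVV (i : 'I_n.+1) : W (V i i).
  have [i0|i0] := posnP i.
    by rewrite (_ : i = ord0) //; apply: ord_inj.
  apply: (Wdiv (nzV ord0 ord0)) => //.
  by rewrite (ptolemy_diameters UV) //; apply: WD; apply: WM; auto.
split=> // i j.
have WVlt (i' j' : 'I_n.+1) : (0 < i')%N -> (i' < j')%N -> W (V i' j').
  move=> i0 ij; apply: (Wdiv (nzV i' ord0)); first by rewrite (ptolemyVC UV).
  by rewrite (ptolemyVV UV) //; apply: WD; apply: WM; auto; rewrite (ptolemyVC UV).
have [i0|i0] := posnP i; first by rewrite (_ : i = ord0) //; apply: ord_inj.
have [j0|j0] := posnP j.
  by rewrite (ptolemyVC UV) (_ : j = ord0) //; apply: ord_inj.
have [ij|ji|/ord_inj <-] := ltngtP i j; [exact: WVlt | | exact: WVV].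
by rewrite (ptolemyVC UV); apply: WVlt.
Qed.

End FanGenerates.

Section FractionPairs.
Context (Q E E' : idomainType) (phi : {rmorphism Q -> E}) (phi' : {rmorphism Q -> E'}).
Hypotheses (phi_inj : injective phi) (phi'_inj : injective phi').

(** The two components of [e] are the images of one formal fraction [f / g]. *)
Definition fraction_pair (e : (E * E')%type) : Prop :=
  exists f g, [/\ g != 0, e.1 * phi g = phi f & e.2 * phi' g = phi' f].

Lemma fraction_pair_gen q : fraction_pair (phi q, phi' q).
Proof. by exists q, 1; rewrite oner_neq0 !rmorph1 !mulr1. Qed.

Lemma fraction_pair1 : fraction_pair 1.
Proof. by have := fraction_pair_gen 1; rewrite !rmorph1. Qed.

Lemma fraction_pairB e e' :
  fraction_pair e -> fraction_pair e' -> fraction_pair (e - e').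
Proof.
case: e e' => [a b] [a' b'] [f [g [g0 /= E1 E2]]] [f' [g' [g'0 /= E1' E2']]].
exists (f * g' - f' * g), (g * g'); rewrite mulf_neq0 // /= !rmorphB !rmorphM /=.
by rewrite -E1 -E1' -E2 -E2'; split=> //; ring.
Qed.

Lemma fraction_pairM e e' :
  fraction_pair e -> fraction_pair e' -> fraction_pair (e * e').
Proof.
case: e e' => [a b] [a' b'] [f [g [g0 /= E1 E2]]] [f' [g' [g'0 /= E1' E2']]].
exists (f * f'), (g * g'); rewrite mulf_neq0 // /= !rmorphM /=.
by rewrite -E1 -E1' -E2 -E2'; split=> //; ring.
Qed.

Lemma fraction_pairD e e' :
  fraction_pair e -> fraction_pair e' -> fraction_pair (e + e').
Proof.
move=> We We'; rewrite -[e']opprK -[- e']sub0r; apply: fraction_pairB => //.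
apply: fraction_pairB => //; rewrite -(subrr 1).
by apply: fraction_pairB; exact: fraction_pair1.
Qed.

Lemma fraction_pair_div e e' : e.1 != 0 ->
  fraction_pair e -> fraction_pair (e * e') -> fraction_pair e'.
Proof.
case: e e' => [a b] [a' b'] /= a0 [f [g [g0 /= E1 E2]]] [f' [g' [g'0 /= E1' E2']]].
have f0 : f != 0.
  have pg : phi g != 0 by rewrite raddf_eq0.
  by apply: contraNneq (mulf_neq0 a0 pg) => f0; rewrite E1 f0 rmorph0.
exists (f' * g), (f * g'); rewrite mulf_neq0 // /= !rmorphM /=.
by rewrite -E1 -E1' -E2 -E2'; split=> //; ring.
Qed.

Lemma fraction_pair_eq0 e : fraction_pair e -> e.1 = 0 <-> e.2 = 0.
Proof.
case: e => [a b] [f [g [g0 /= E1 E2]]].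
have pg : phi g != 0 by rewrite raddf_eq0.
have pg' : phi' g != 0 by rewrite raddf_eq0.
split=> e0; apply/eqP.
  move: E1 E2; rewrite e0 mul0r => /esym/eqP; rewrite raddf_eq0 // => /eqP ->.
  by rewrite rmorph0 => /eqP; rewrite mulf_eq0 (negbTE pg') orbF.
move: E2 E1; rewrite e0 mul0r => /esym/eqP; rewrite raddf_eq0 // => /eqP ->.
by rewrite rmorph0 => /eqP; rewrite mulf_eq0 (negbTE pg) orbF.
Qed.

End FractionPairs.

(** * Evaluating polynomials in the fan and side variables *)

(** The sides [[k, k + 1]]; the last one joins [n] to [bar 0]. *)
Definition side_generator (n : nat) (E : Type) (U V : 'I_n.+1 -> 'I_n.+1 -> E)
  (k : 'I_n.+1) : E :=
  if k == n :> nat then V ord0 ord_max else U k (inord k.+1).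

(** The index 0 is given to the diameter, so that the index [k > 0] denotes
    [[0, k + 1]]. *)
Definition fan_generator (n : nat) (E : Type) (U V : 'I_n.+1 -> 'I_n.+1 -> E)
  (k : 'I_n) : E :=
  if k == 0%N :> nat then V ord0 ord0 else U ord0 (lift ord0 k).

Section Evaluation.
Context (n : nat).
Local Notation Q := {mpoly {mpoly int[n.+1]}[n]}.

(** Polynomials in the fan variables whose coefficients are polynomials in the
    side variables; the nesting separates the roles of the cluster and of the
    coefficients in the independence proof. *)
Definition nested_eval (E : comNzRingType) (s : 'I_n.+1 -> E) (t : 'I_n -> E) : Q -> E :=
  mmap (mmap intr s) t.

HB.instance Definition _ (E : comNzRingType) (s : 'I_n.+1 -> E) (t : 'I_n -> E) :=
  GRing.RMorphism.copy (nested_eval s t) (mmap (mmap intr s) t).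

Lemma nested_eval_fan (E : comNzRingType) (s : 'I_n.+1 -> E) (t : 'I_n -> E) k :
  nested_eval s t 'X_k = t k.
Proof.
by rewrite [LHS](mmapX t (mmap intr s : {rmorphism {mpoly int[n.+1]} -> E})) mmap1U.
Qed.

Lemma nested_eval_side (E : comNzRingType) (s : 'I_n.+1 -> E) (t : 'I_n -> E) k :
  nested_eval s t ('X_k)%:MP = s k.
Proof.
rewrite [LHS](mmapC t (mmap intr s : {rmorphism {mpoly int[n.+1]} -> E})) /=.
by rewrite [LHS](mmapX s (intr : {rmorphism int -> E})) mmap1U.
Qed.

Lemma mmap_morph (R E E' : comNzRingType) (chi : {rmorphism E -> E'}) k
    (f : R -> E) (f' : R -> E') (h : 'I_k -> E) (h' : 'I_k -> E') p :
  chi \o f =1 f' -> chi \o h =1 h' -> chi (mmap f h p) = mmap f' h' p.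
Proof.
move=> ff' hh'; rewrite /mmap raddf_sum /=; apply: eq_bigr => m _.
rewrite rmorphM rmorph_prod -ff' /=; congr (_ * _).
by apply: eq_bigr => i _; rewrite rmorphXn -hh'.
Qed.

Lemma nested_eval_morph (E E' : comNzRingType) (chi : {rmorphism E -> E'})
    (s : 'I_n.+1 -> E) (t : 'I_n -> E) (s' : 'I_n.+1 -> E') (t' : 'I_n -> E') q :
  chi \o s =1 s' -> chi \o t =1 t' -> chi (nested_eval s t q) = nested_eval s' t' q.
Proof.
move=> ss' tt'; apply: mmap_morph => // p; apply: mmap_morph => // c /=.
exact: rmorph_int.
Qed.

Lemma meval_map_mpoly (R S : comNzRingType) (f : {rmorphism R -> S}) k
    (v : 'I_k -> S) (p : {mpoly R[k]}) : (map_mpoly f p).@[v] = mmap f v p.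
Proof.
by apply: mmap_morph => [c|i] /=; rewrite ?mevalC ?mevalXU.
Qed.

Lemma map_mpoly_inj (R S : nzRingType) (f : {additive R -> S}) k :
  injective f -> injective (@map_mpoly k R S f).
Proof.
move=> f_inj p q pq; apply/mpolyP => m; apply: f_inj.
by rewrite -!mcoeff_map_mpoly pq.
Qed.

Lemma nested_eval_nonroot (C : numDomainType) (q : Q) : q != 0 ->
  exists s : 'I_n.+1 -> C, exists t : 'I_n -> C,
    [/\ forall i, s i != 0, forall i, t i != 0 & nested_eval s t q != 0].
Proof.
move=> q0; have [m qm0] : exists m, q@_m != 0.
  apply: contra_neqP q0 => H; apply/mpolyP => m; rewrite mcoeff0.
  by apply/eqP; apply: contrapT => /negP ?; apply: H; exists m.
have inj_int : injective (intr : int -> C) by exact: intr_inj.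
have /mpoly_nonroot [s [s0 ms0]] : map_mpoly (intr : int -> C) q@_m != 0.
  by apply: contra_neq qm0 => E; apply: (map_mpoly_inj inj_int); rewrite E raddf0.
have /mpoly_nonroot [t [t0 mt0]] : map_mpoly (mmap (intr : int -> C) s) q != 0.
  apply: contra_neq ms0 => /mpolyP/(_ m).
  by rewrite mcoeff_map_mpoly mcoeff0 meval_map_mpoly.
by exists s, t; split=> //; rewrite /nested_eval -meval_map_mpoly.
Qed.

End Evaluation.

Section Reconstruction.
Context (C : numClosedFieldType) (n : nat).
Hypothesis n1 : (0 < n)%N.

(** The Pluecker relation for [0, k, k + 1] and [bar 0] is solved for the label
    [D k] of [[0, bar k]], starting from the side [D n]. *)
Lemma downward_solution (tau : C) (s B : nat -> C) : (forall k, B k.+1 != 0) ->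
  exists D : nat -> C, D n = s n /\
    forall k, (k < n)%N -> D k * B k.+1 = s k * tau + D k.+1 * B k.
Proof.
move=> B0; pose step j e := (s (n - j.+1)%N * tau + e * B (n - j.+1)%N) / B (n - j.+1).+1.
pose e := nat_rect (fun=> C) (s n) step.
exists (fun k => e (n - k)%N); split=> [|k kn]; first by rewrite subnn.
rewrite [in LHS](_ : n - k = (n - k.+1).+1)%N; last by lia.
rewrite /= {1}/step (_ : n - (n - k.+1).+1 = k)%N; last by lia.
by rewrite divfK.
Qed.

(** In the basis [v_0, J v_0] the vector [v_k] has coordinates proportional to
    [D k = v_0 . v_k] and [B k = det (v_0, v_k)], and [det (v_k, v_l)] is
    [(D k * B l - D l * B k) / tau] with [tau = v_0 . v_0].  The fan fixes [tau]
    and [B], and [downward_solution] finds [D]. *)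
Lemma reconstruction (s : 'I_n.+1 -> C) (t : 'I_n -> C) :
  (forall i, s i != 0) -> (forall i, t i != 0) ->
  exists M : 'M[C]_(2, n.+1),
    let U i j := M 0 i * M 1 j - M 0 j * M 1 i in
    let V i j := M 0 i * M 0 j + M 1 i * M 1 j in
    side_generator U V =1 s /\ fan_generator U V =1 t.
Proof.
move=> s0 t0; pose tau := t (Ordinal n1).
have tau0 : tau != 0 by apply: t0.
pose B k := if k == 0%N then 0 else if k == 1%N then s ord0 else
  if insub k.-1 is Some i then t i else 1.
have B0 k : B k.+1 != 0.
  by rewrite /B /=; case: ifP => // _; case: insub => [i|]; rewrite ?oner_eq0.
have [D [Dn DB]] := downward_solution tau (fun k => s (inord k)) B0.
have D0 : D 0%N = tau.
  apply: (mulIf (B0 0%N)); rewrite DB // {2}/B /= mulr0 addr0 mulrC.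
  by congr (_ * s _); apply: ord_inj; rewrite inordK.
(* A vector [v_0] = (x0, y0) with [v_0 . v_0 = tau] that avoids square roots. *)
pose x0 := (tau + 1) / 2; pose y0 := (tau - 1) / (2 * 'i).
have n2 : 2%:R != 0 :> C by rewrite pnatr_eq0.
have xy : x0 ^+ 2 + y0 ^+ 2 = tau.
  by rewrite /x0 /y0 !expr_div_n !exprMn sqrCi; field.
exists (\matrix_(i, k) if i == 0 then (D k * x0 - B k * y0) / tau
                       else (D k * y0 + B k * x0) / tau).
have UE (i j : nat) : (D i * x0 - B i * y0) / tau * ((D j * y0 + B j * x0) / tau)
    - (D j * x0 - B j * y0) / tau * ((D i * y0 + B i * x0) / tau)
    = (D i * B j - D j * B i) / tau.
  transitivity ((x0 ^+ 2 + y0 ^+ 2) * (D i * B j - D j * B i) / tau ^+ 2).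
    by move: (x0) (y0) => x1 y1; field.
  by rewrite xy; field.
have VE (i j : nat) : (D i * x0 - B i * y0) / tau * ((D j * x0 - B j * y0) / tau)
    + (D i * y0 + B i * x0) / tau * ((D j * y0 + B j * x0) / tau)
    = (D i * D j + B i * B j) / tau.
  transitivity ((x0 ^+ 2 + y0 ^+ 2) * (D i * D j + B i * B j) / tau ^+ 2).
    by move: (x0) (y0) => x1 y1; field.
  by rewrite xy; field.
split=> k.
  rewrite /side_generator; case: ifP => [/eqP kn|kn]; rewrite !mxE /=.
    rewrite VE {1}D0 Dn {1}/B /= mul0r addr0 mulrC mulKf //.
    by congr s; apply: ord_inj; rewrite inordK.
  have kltn : (k < n)%N by have := ltn_ord k; lia.
  rewrite inordK // UE DB // addrK mulfK //; congr s; apply: ord_inj.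
  by rewrite inordK.
rewrite /fan_generator; case: ifP => [/eqP k0|k0]; rewrite !mxE /=.
  rewrite VE D0 {1 2}/B /= mulr0 addr0 mulfK //; congr t; exact: ord_inj.
rewrite UE D0 {2}/B /= mulr0 subr0 mulrC mulKf //.
rewrite /B /bump /= add1n /= eqSS k0.
by case: insubP => [i _ ik|]; [congr t; apply: ord_inj | rewrite ltn_ord].
Qed.

End Reconstruction.

(** * Invariants of the special orthogonal group of the plane *)

Section Invariants.
Context (C : numClosedFieldType) (n : nat).
Implicit Types (a b : 'I_n.+1).
Local Notation mxpol := {mpoly C[2 * n.+1]}.
Local Notation z := (zcoord C).

Lemma Delta_ptolemy_system : ptolemy_system (@Delta C n) (@Deltabar C n).
Proof.
by split=> *; rewrite /Delta /Deltabar; ring.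
Qed.

Lemma eval_zcoord i a (M : 'M[C]_(2, n.+1)) : eval_mx (z i a) M = M i a.
Proof. by rewrite /eval_mx /zcoord mevalXU mxvecE. Qed.

Lemma eval_Delta a b (M : 'M[C]_(2, n.+1)) :
  eval_mx (Delta C a b) M = M 0 a * M 1 b - M 0 b * M 1 a.
Proof. by rewrite /eval_mx mevalB !mevalM -!/(eval_mx _ _) !eval_zcoord. Qed.

Lemma eval_Deltabar a b (M : 'M[C]_(2, n.+1)) :
  eval_mx (Deltabar C a b) M = M 0 a * M 0 b + M 1 a * M 1 b.
Proof. by rewrite /eval_mx mevalD !mevalM -!/(eval_mx _ _) !eval_zcoord. Qed.

Lemma rot2_mul u v (M : 'M[C]_(2, n.+1)) a :
  (rot2 u v *m M) 0 a = u * M 0 a - v * M 1 a /\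
  (rot2 u v *m M) 1 a = v * M 0 a + u * M 1 a.
Proof.
by rewrite !mxE !big_ord_recl !big_ord0 !mxE /= !addr0 mulNr
  (_ : lift ord0 ord0 = 1) //; apply: ord_inj.
Qed.

Lemma Delta_invariant a b : Delta C a b \in @so2_invariant C n.
Proof.
apply/asboolP => u v uv M; rewrite !eval_Delta.
have [-> ->] := rot2_mul u v M a; have [-> ->] := rot2_mul u v M b.
by rewrite -[RHS]mul1r -uv; ring.
Qed.

Lemma Deltabar_invariant a b : Deltabar C a b \in @so2_invariant C n.
Proof.
apply/asboolP => u v uv M; rewrite !eval_Deltabar.
have [-> ->] := rot2_mul u v M a; have [-> ->] := rot2_mul u v M b.
by rewrite -[RHS]mul1r -uv; ring.
Qed.

Lemma prod_exp_seq (E : comNzRingType) (I : finType) (w : I -> E) (m : I -> nat) :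
  exists2 s : seq I, size s = (\sum_i m i)%N & \prod_i w i ^+ m i = \prod_(i <- s) w i.
Proof.
exists (flatten [seq nseq (m i) i | i <- index_enum I]).
  rewrite size_flatten sumnE /shape -map_comp big_map; apply: eq_bigr => i _.
  by rewrite /= size_nseq.
rewrite big_flatten big_map; apply: eq_bigr => i _.
by rewrite big_nseq; elim: (m i) => //= k <-; rewrite exprS.
Qed.

(** Factors [w i] and [w' j] are matched arbitrarily, one of each at a time. *)
Lemma balanced_prod (E : comNzRingType) (I : finType) (P : E -> Prop)
    (w w' : I -> E) (m m' : I -> nat) :
  P 1 -> (forall p q, P p -> P q -> P (p * q)) -> (forall i j, P (w i * w' j)) ->
  (\sum_i m i = \sum_i m' i)%N -> P (\prod_i w i ^+ m i * \prod_i w' i ^+ m' i).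
Proof.
move=> P1 PM Pw; have [s <- ->] := prod_exp_seq w m.
have [s' <- ->] := prod_exp_seq w' m'.
elim: s s' => [|i s IH] [|j s'] //=; first by rewrite !big_nil mulr1.
by case=> /IH; rewrite !big_cons mulrACA; apply: PM.
Qed.

Lemma prod_mxvec2 (R : comNzRingType) (q : nat) (h : 'I_2 -> 'I_q -> R)
    (h' : 'I_(2 * q) -> R) : (forall i j, h' (mxvec_index i j) = h i j) ->
  \prod_k h' k = (\prod_j h 0 j) * \prod_j h 1 j.
Proof.
move=> hh'; rewrite (reindex _ (curry_mxvec_bij 2 q)) /=.
transitivity (\prod_i \prod_j h i j).
  by rewrite pair_big /=; apply: eq_bigr => -[i j] _ /=.
pose H i := \prod_j h i j; rewrite -/(H 0) -/(H 1) -[LHS]/(\prod_i H i).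
by rewrite !big_ord_recl big_ord0 mulr1 (_ : lift ord0 ord0 = 1) //; apply: ord_inj.
Qed.

(** The coordinates [z_1a + i z_2a] and [z_1a - i z_2a] diagonalize the rotations:
    they are multiplied by [u + i v] and by its inverse. *)
Definition isotropic_mx : 'M[mxpol]_(2, n.+1) :=
  \matrix_(i, a) (z 0 a + (if i == 0 then 'i else - 'i) *: z 1 a).

Definition isotropic_inv_mx : 'M[mxpol]_(2, n.+1) :=
  \matrix_(i, a) (if i == 0 then 2^-1 *: (z 0 a + z 1 a)
                  else (2 * 'i)^-1 *: (z 0 a - z 1 a)).

Definition mx_tuple (A : 'M[mxpol]_(2, n.+1)) : (2 * n.+1).-tuple mxpol :=
  [tuple mxvec A 0 k | k < 2 * n.+1].

Lemma tnth_mx_tuple A i a : tnth (mx_tuple A) (mxvec_index i a) = A i a.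
Proof. by rewrite tnth_mktuple mxvecE. Qed.

Lemma two_neq0 : 2 != 0 :> C. Proof. by rewrite pnatr_eq0. Qed.

Lemma isotropic_change (f : mxpol) :
  (f \mPo mx_tuple isotropic_inv_mx) \mPo mx_tuple isotropic_mx = f.
Proof.
have L i a : z i a \mPo mx_tuple isotropic_mx = isotropic_mx i a.
  by rewrite /zcoord comp_mpolyXU -tnth_nth tnth_mx_tuple.
have -> : (f \mPo mx_tuple isotropic_inv_mx) \mPo mx_tuple isotropic_mx =
    f \mPo [tuple 'X_k | k < 2 * n.+1].
  apply: mmap_morph => [c|k] /=; first by rewrite comp_mpolyC.
  case/mxvec_indexP: k => i a; rewrite tnth_mx_tuple tnth_mktuple -/(z i a) mxE.
  have i0 := neq0Ci C; have n2 := two_neq0.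
  have [->|->] : i = 0 \/ i = 1.
    by case: i => -[|[|//]] ?; [left|right]; apply: ord_inj.
    rewrite eqxx comp_mpolyZ comp_mpolyD !L !mxE /= scaleNr addrACA subrr addr0.
    by rewrite -mulr2n -scaler_nat scalerA mulVf ?scale1r.
  rewrite /= comp_mpolyZ comp_mpolyB !L !mxE /= scaleNr opprD opprK addrACA subrr add0r.
  by rewrite -scalerDl -mulr2n -(mulr_natl 'i) scalerA mulVf ?scale1r ?mulf_neq0.
exact: comp_mpoly_id.
Qed.

(** The effect in isotropic coordinates of the rotation with [u + i v = 2], that
    is [u = 5/4] and [v = -3i/4]. *)
Definition weight_scale (k : 'I_(2 * n.+1)) : C :=
  mxvec (\matrix_(i < 2, a < n.+1) (if i == 0 then 2 else 2^-1 : C)) 0 k.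

Definition point_mx (w : 'I_(2 * n.+1) -> C) : 'M[C]_(2, n.+1) :=
  \matrix_(i, a) (isotropic_inv_mx i a).@[w].

Lemma eval_isotropic_inv (f : mxpol) w :
  (f \mPo mx_tuple isotropic_inv_mx).@[w] = eval_mx f (point_mx w).
Proof.
rewrite comp_mpoly_meval; apply: meval_eq => k.
by case/mxvec_indexP: k => i a; rewrite tnth_mx_tuple mxvecE [RHS]mxE.
Qed.

Lemma meval_zcoord w i a : (z i a).@[w] = w (mxvec_index i a).
Proof. by rewrite /zcoord mevalXU. Qed.

Lemma point_mx_scale w :
  point_mx (fun k => weight_scale k * w k) =
  rot2 (5%:R / 4%:R) (- (3%:R / 4%:R) * 'i) *m point_mx w.
Proof.
have i0 := neq0Ci C; have n2 := two_neq0.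
have n4 : 4%:R != 0 :> C by rewrite pnatr_eq0.
apply/matrixP => i a.
have [E0 E1] := rot2_mul (5%:R / 4%:R) (- (3%:R / 4%:R) * 'i) (point_mx w) a.
have [->|->] : i = 0 \/ i = 1.
  by case: i => -[|[|//]] ?; [left|right]; apply: ord_inj.
- rewrite E0 !mxE /= !mevalZ !mevalD !mevalN !meval_zcoord /weight_scale !mxvecE !mxE /=.
  by field.
have invi : (2 * 'i)^-1 = - 'i / 2 :> C.
  by rewrite invfM invCi mulrC.
rewrite E1 !mxE /= !mevalZ !mevalD !mevalN !meval_zcoord /weight_scale !mxvecE !mxE /=.
by rewrite invi; field.
Qed.

Lemma invariant_scale (f : mxpol) w : f \in @so2_invariant C n ->
  (f \mPo mx_tuple isotropic_inv_mx).@[fun k => weight_scale k * w k] =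
  (f \mPo mx_tuple isotropic_inv_mx).@[w].
Proof.
move/asboolP => inv; rewrite !eval_isotropic_inv point_mx_scale; apply: inv.
rewrite [X in _ + X]exprMn sqrCi; have n4 : 4%:R != 0 :> C by rewrite pnatr_eq0.
by field.
Qed.

(** A single rotation suffices: the scaling by [(2, 1/2)] multiplies a monomial by
    a power of 2, which is 1 only for balanced monomials. *)
Lemma invariant_weight (f : mxpol) m : f \in @so2_invariant C n ->
  m \in msupp (f \mPo mx_tuple isotropic_inv_mx) ->
  (\sum_a m (mxvec_index (0%R : 'I_2) a) = \sum_a m (mxvec_index (1%R : 'I_2) a))%N.
Proof.
move=> inv; set g := _ \mPo _ => mg.
pose c (m : 'X_{1..2 * n.+1}) := \prod_k weight_scale k ^+ m k.
pose g' := \sum_(m <- msupp g) (g@_m * c m) *: 'X_[m].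
have g'E : g' = g.
  apply/eqP; rewrite -subr_eq0; apply: contraT => /mpoly_nonroot [w [_]].
  rewrite mevalB -(invariant_scale w inv) -/g => /eqP [].
  apply/eqP; rewrite subr_eq0; apply/eqP.
  rewrite raddf_sum mevalE; apply: eq_bigr => m' _ /=.
  rewrite mevalZ mevalX -mulrA -big_split; congr (_ * _).
  by apply: eq_bigr => k _ /=; rewrite exprMn.
have cm : c m = 1.
  have gm0 : g@_m != 0 by rewrite -mcoeff_msupp.
  have g'm : g'@_m = g@_m * c m.
    rewrite {1}/g' raddf_sum (bigD1_seq m) ?msupp_uniq //= mcoeffZ mcoeffX eqxx mulr1.
    rewrite big1 ?addr0 // => m' /negbTE m'm.
    by rewrite mcoeffZ mcoeffX m'm mulr0.
  by apply: (mulfI gm0); rewrite mulr1 -g'm g'E.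
move: cm; rewrite /c (prod_mxvec2 (h := fun i a => (if i == 0 then 2 else 2^-1) ^+ m (mxvec_index i a))).
  rewrite /= -!expr_sum exprVn => /divr1_eq.
  move/eqP; rewrite -!natrX eqr_nat eqn_exp2l // => /eqP.
  by [].
by move=> i a; rewrite /weight_scale mxvecE mxE.
Qed.

(** In isotropic coordinates an invariant is a combination of balanced monomials,
    hence of products of the
    [(z_1a + i z_2a) (z_1b - i z_2b) = Delta_(a, bar b) - i Delta_(a, b)]. *)
Lemma so2_invariant_generated (P : mxpol -> Prop) :
  (forall c, P c%:MP) -> (forall p q, P p -> P q -> P (p + q)) ->
  (forall p q, P p -> P q -> P (p * q)) ->
  (forall a b, (a < b)%N -> P (Delta C a b)) ->
  (forall a b, (a <= b)%N -> P (Deltabar C a b)) ->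
  forall f, f \in @so2_invariant C n -> P f.
Proof.
move=> PC PD PM PDelta PDeltabar f inv.
have PZ c p : P p -> P (c *: p) by rewrite -mul_mpolyC; apply: PM.
have DeltaC a b : Delta C a b = - Delta C b a by rewrite /Delta opprB.
have PDelta' a b : P (Delta C a b).
  have [ab|ba|/ord_inj <-] := ltngtP a b; first exact: PDelta.
    by rewrite DeltaC -scaleN1r; apply/PZ/PDelta.
  by rewrite /Delta subrr -mpolyC0.
have PDeltabar' a b : P (Deltabar C a b).
  have [|/ltnW ba] := leqP a b; first exact: PDeltabar.
  have -> : Deltabar C a b = Deltabar C b a by rewrite /Deltabar; ring.
  exact: PDeltabar.
rewrite -(isotropic_change f); set g := (f \mPo _).
rewrite comp_mpolyEX; rewrite big_seq; apply: (big_ind P) => [|//|m mg].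
  by rewrite -mpolyC0.
apply: (PZ); rewrite comp_mpolyX.
rewrite (prod_mxvec2 (h := fun i a => isotropic_mx i a ^+ m (mxvec_index i a))); last first.
  by move=> i a; rewrite tnth_mx_tuple.
apply: (@balanced_prod _ _ P (isotropic_mx 0) (isotropic_mx 1)
  (fun a => m (mxvec_index 0 a)) (fun a => m (mxvec_index 1 a))) => //.
- by rewrite -mpolyC1.
- move=> a b; rewrite !mxE /=.
  have -> : (z 0 a + 'i *: z 1 a) * (z 0 b + - 'i *: z 1 b) =
      Deltabar C a b + (- 'i) *: Delta C a b.
    have ii : 'i%:MP_[2 * n.+1] * 'i%:MP = - 1 :> mxpol.
      by rewrite -mpolyCM -expr2 sqrCi mpolyCN mpolyC1.
    rewrite /Deltabar /Delta -!mul_mpolyC mpolyCN.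
    transitivity (z 0 a * z 0 b - ('i%:MP * 'i%:MP) * (z 1 a * z 1 b)
      - 'i%:MP * (z 0 a * z 1 b - z 0 b * z 1 a)); first by ring.
    by rewrite ii; ring.
  by apply: PD => //; apply: PZ.
exact: invariant_weight inv mg.
Qed.

End Invariants.

(** * Z-forms spanned by integral polynomials *)

Section IntegralRelations.
Context (C : numFieldType) (k l : nat) (c : 'I_k -> C) (M : 'M[int]_(k, l)).
Hypothesis cM : forall t, \sum_i c i * (M i t)%:~R = 0.

(** Smith normal form: after an invertible integral change [L] of the coefficients
    [c], the rows of [M] become [L' *m M], and each of them is either zero or
    independent of the others, so that its new coefficient vanishes. *)
Lemma integral_relation : exists L L' : 'M[int]_k,
  L *m L' = 1%:M /\
  forall j, \sum_i c i * (L i j)%:~R = 0 \/ forall t, (L' *m M) j t = 0.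
Proof.
have [L uL [U uU [d _ ME]]] := int_Smith_normal_form M.
set Dg := (\matrix_(i, j) _) in ME.
exists L, (invmx L); rewrite mulmxV //; split=> // j.
pose toC (m1 m2 : nat) (A : 'M[int]_(m1, m2)) : 'M[C]_(m1, m2) := map_mx intr A.
pose cC : 'rV[C]_k := \row_i c i.
have cC0 : cC *m toC _ _ M = 0.
  apply/rowP => t; rewrite !mxE -[RHS](cM t); apply: eq_bigr => i _.
  by rewrite !mxE.
have cLD : cC *m toC _ _ L *m toC _ _ Dg = 0.
  have UV : toC _ _ U *m toC _ _ (invmx U) = 1%:M.
    by rewrite /toC -map_mxM mulmxV // map_mx1.
  rewrite -[LHS]mulmx1 -UV mulmxA -[_ *m toC _ _ U]mulmxA -(mulmxA cC).
  by rewrite /toC -map_mxM -map_mxM mulmxA -ME -/(toC _ _ M) cC0 mul0mx.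
(* [Dg] has at most one nonzero entry in each row and column. *)
have [Dj0|] := pselect (forall t, Dg j t = 0).
  right=> t; rewrite ME -mulmxA mulKmx // mxE big1 // => i _.
  by rewrite Dj0 mul0r.
move=> /existsNP [t Djt]; left.
have jt : j = t :> nat.
  by apply: contra_notP Djt; rewrite mxE => /eqP/negbTE ->; rewrite mulr0n.
have := congr1 (fun A : 'rV[C]_l => A 0 t) cLD; rewrite !mxE (bigD1 j) //= big1 => [|i ij].
  rewrite addr0 [X in _ * X]mxE => /eqP; rewrite mulf_eq0 intr_eq0 => /orP[|/eqP //].
  rewrite mxE => /eqP E; rewrite -[RHS]E; apply: eq_bigr => i _; by rewrite !mxE.
rewrite [X in _ * X]mxE [X in X%:~R]mxE -jt (inj_eq val_inj) (negbTE ij).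
by rewrite mulr0n mulr0.
Qed.

End IntegralRelations.

Section Biadditive.
Context (A B G : zmodType) (f : A -> B -> G).
Hypothesis hf : biadditive f.

Lemma biadditive_zmodl b : zmod_morphism (f^~ b).
Proof.
move=> a a' /=; apply/eqP; rewrite eq_sym subr_eq -hf.1 subrK //.
Qed.

Lemma biadditive_zmodr a : zmod_morphism (f a).
Proof.
move=> b b' /=; apply/eqP; rewrite eq_sym subr_eq -hf.2 subrK //.
Qed.

Definition biadditive_l b : {additive A -> G} :=
  HB.pack (f^~ b) (GRing.isZmodMorphism.Build A G (f^~ b) (biadditive_zmodl b)).

Definition biadditive_r a : {additive B -> G} :=
  HB.pack (f a) (GRing.isZmodMorphism.Build B G (f a) (biadditive_zmodr a)).

Lemma biadditiveNl a b : f (- a) b = - f a b.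
Proof. exact: (raddfN (biadditive_l b)). Qed.

End Biadditive.

Section Zform.
Context (C : numFieldType) (N : nat) (R : comAlgType C) (RZ : subringClosed R).
Context (emb : {linear R -> {mpoly C[N]}}).
Hypothesis emb_inj : injective emb.
Hypothesis integral : forall r : subring_of RZ,
  exists p : {mpoly int[N]}, emb (\val r) = map_mpoly intr p.
Hypothesis spanned : forall r : R, exists l : seq (C * subring_of RZ),
  r = \sum_(x <- l) x.1 *: \val x.2.

(** The change of coefficients provided by [integral_relation] can be carried out
    through [f] because it is integral. *)
Lemma biadditive_relation (G : zmodType) (f : C -> subring_of RZ -> G) :
  biadditive f -> forall l : seq (C * subring_of RZ),
  \sum_(x <- l) x.1 *: \val x.2 = 0 :> R -> \sum_(x <- l) f x.1 x.2 = 0.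
Proof.
move=> hf l; pose k := size l.
pose c (i : 'I_k) := (nth (0, 0) l i).1; pose r (i : 'I_k) := (nth (0, 0) l i).2.
rewrite !(big_nth (0, 0)) !big_mkord -/k.
rewrite -[X in X = 0 -> _]/(\sum_i c i *: \val (r i)).
rewrite -[X in _ -> X = 0]/(\sum_i f (c i) (r i)) => rel.
have [p pE] := choice (fun i => integral (r i)).
pose s := undup (flatten [seq msupp (p i) | i <- enum 'I_k]).
pose M : 'M[int]_(k, size s) := \matrix_(i, t) (p i)@_(nth 0%MM s t).
have p_out i m : m \notin s -> (p i)@_m = 0.
  move=> ms; apply: memN_msupp_eq0; apply: contra ms => mp.
  rewrite mem_undup; apply/flatten_mapP; exists i => //.
  by rewrite mem_enum.
have cM t : \sum_i c i * (M i t)%:~R = 0.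
  have := congr1 (mcoeff (nth 0%MM s t)) (congr1 emb rel).
  rewrite raddf0 mcoeff0 !raddf_sum /= => {2}<-; apply: eq_bigr => i _.
  by rewrite linearZ /= mcoeffZ pE mcoeff_map_mpoly mxE.
have [L [L' [LL' cL]]] := integral_relation cM.
pose e j := \sum_i r i *~ L' j i.
have rE i : r i = \sum_j e j *~ L i j.
  transitivity (\sum_i' r i' *~ (L *m L') i i').
    rewrite LL' (bigD1 i) //= mxE eqxx mulr1z big1 ?addr0 // => i' ii'.
    by rewrite mxE eq_sym (negbTE ii') mulr0z.
  under eq_bigr => i' _ do rewrite mxE mulrz_sumr.
  rewrite exchange_big; apply: eq_bigr => j _ /=.
  by rewrite /e mulrz_suml; apply: eq_bigr => i' _; rewrite mulrC mulrzA.
have e0 j : (forall t, (L' *m M) j t = 0) -> e j = 0.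
  move=> LM; apply: val_inj; apply: emb_inj; rewrite raddf0.
  rewrite /e !raddf_sum /=; apply/mpolyP => m; rewrite mcoeff0 raddf_sum /=.
  have coefE i : (emb (\val (r i *~ L' j i)))@_m = (L' j i * (p i)@_m)%:~R.
    by rewrite !raddfMz /= pE mcoeff_map_mpoly mulrC intrM -mulrzr.
  under eq_bigr => i _ do rewrite coefE.
  have [ms|ms] := boolP (m \in s); last first.
    by rewrite big1 // => i _; rewrite p_out ?mulr0.
  have ts : (index m s < size s)%N by rewrite index_mem.
  rewrite -raddf_sum /= -[RHS](_ : ((L' *m M) j (Ordinal ts))%:~R = 0); last by rewrite LM.
  by congr _%:~R; rewrite mxE; apply: eq_bigr => i _; rewrite mxE nth_index.
rewrite (eq_bigr (fun i => \sum_j f (c i *~ L i j) (e j))); last first.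
  move=> i _; rewrite {1}rE -[f (c i)]/(biadditive_r hf (c i) : _ -> _) raddf_sum.
  apply: eq_bigr => j _.
  by rewrite -[f _ _]/(biadditive_l hf (e j) _) !raddfMz.
rewrite exchange_big big1 //= => j _.
rewrite -[LHS]/(\sum_i biadditive_l hf (e j) (c i *~ L i j)) -raddf_sum.
have [cj|LM] := cL j; last by rewrite (e0 j LM) /= -[f _ 0]/(biadditive_r hf _ 0) raddf0.
under eq_bigr => i _ do rewrite -mulrzr.
by rewrite cj raddf0.
Qed.

Lemma scale_biadditive : biadditive (fun (c : C) (r : subring_of RZ) => c *: \val r : R).
Proof.
split=> [c c' r|c r r']; first exact: scalerDl.
by rewrite -scalerDr -raddfD.
Qed.

(** The map out of the tensor product is defined on a chosen expansion;
    [biadditive_relation] makes it independent of the choice. *)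
Lemma integral_subring_Zform : is_Zform RZ.
Proof.
split=> [|G f hf]; first exact: scale_biadditive.
have rel := biadditive_relation hf; have [l lE] := choice spanned.
pose h (r : R) := \sum_(x <- l r) f x.1 x.2.
pose opp (l' : seq (C * subring_of RZ)) := [seq (- x.1, x.2) | x <- l'].
have sum_opp (l' : seq (C * subring_of RZ)) :
    \sum_(x <- opp l') f x.1 x.2 = - \sum_(x <- l') f x.1 x.2.
  by rewrite big_map -sumrN; apply: eq_bigr => x _; exact: biadditiveNl.
have scale_opp (l' : seq (C * subring_of RZ)) :
    \sum_(x <- opp l') x.1 *: \val x.2 = - \sum_(x <- l') x.1 *: \val x.2 :> R.
  by rewrite big_map -sumrN; apply: eq_bigr => x _; rewrite scaleNr.
have eval_eq (r : R) (l' : seq (C * subring_of RZ)) :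
    r = \sum_(x <- l') x.1 *: \val x.2 -> h r = \sum_(x <- l') f x.1 x.2.
  move=> rE; apply/eqP; rewrite -subr_eq0; apply/eqP.
  by have := rel (l r ++ opp l'); rewrite !big_cat sum_opp scale_opp /= -lE -rE subrr; apply.
have h_zmod : zmod_morphism h.
  move=> r r'; rewrite (eval_eq _ (l r ++ opp (l r'))); rewrite big_cat ?sum_opp //.
  by rewrite scale_opp /= -!lE.
pose H : {additive R -> G} := HB.pack h (GRing.isZmodMorphism.Build R G h h_zmod).
exists H; split=> [c r|h' h'E r].
  by rewrite /= (eval_eq _ [:: (c, r)]) big_seq1.
rewrite [in LHS](lE r) raddf_sum /= /h; apply: eq_bigr => x _; exact: h'E.
Qed.

End Zform.

(** * The fan seed and independence of the fan labels *)

Section TropExponents.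
Context (J : finType).

Lemma trop_expE (p : trop J) k j : (p ^+ k)%g j = p j *+ k.
Proof.
elim: k => [|k IH]; first by rewrite expg0 mulr0n ffunE.
by rewrite expgS ffunE IH mulrS.
Qed.

Lemma trop_prodE (I : finType) (p : I -> trop J) j :
  (\prod_i p i)%g j = \sum_i p i j.
Proof.
rewrite (big_morph (fun q : trop J => q j) (id1 := 0) (op1 := +%R)) //.
  by move=> q q'; rewrite ffunE.
by rewrite ffunE.
Qed.

End TropExponents.

Section FanSeed.
Context (n : nat) (F : fieldType) (iota : tropC n -> F).
Context (x : {set {set vertex n}} -> F) (s0 : seed n iota).
Hypotheses (n2 : (1 < n)%N) (hF : ambient_field n iota) (hA : is_Acirc x s0).
Implicit Types i j k : 'I_n.+1.

Definition plain_label i j := labeled iota x (orbit_of (vtx i) (vtx j)).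
Definition barred_label i j := labeled iota x (orbit_of (vtx i) (bar (vtx j))).

Lemma label_ptolemy_system : ptolemy_system plain_label barred_label.
Proof.
split.
- exact: label_ptolemy n2 hF hA.
- exact: label_ptolemy_bar n2 hF hA.
- exact: label_ptolemy_bar0 n2 hF hA.
- exact: label_diameters n2 hF hA.
- by move=> i j; exact: label_barC.
Qed.

Lemma vtx_neq i j : (i < j)%N -> vtx i != vtx j.
Proof. by move=> ij; rewrite -(inj_eq (@ord_inj _)) !val_vtx ltn_eqF. Qed.

Lemma vtx_bar_neq i j : vtx i != bar (vtx j).
Proof.
have hi := ltn_ord i; have hj := ltn_ord j.
by rewrite -(inj_eq (@ord_inj _)) val_bar !val_vtx ifT; lia.
Qed.

Lemma cvar_inj (s : seed n iota) : injective (cvar s).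
Proof.
move=> i j E; apply/eqP/negPn/negP => ij; have [indep _] := seed_basis s.
have := indep ('X_i - 'X_j); rewrite mevalB !mevalXU E subrr => /(_ _ erefl) H.
have : 'X_i - 'X_j = 0 :> {mpoly F[n]}.
  by apply: H; apply/mpolyOverP => m; rewrite mcoeffB !mcoeffX rpredB // rpred_nat.
move/mpolyP/(_ U_(i)%MM); rewrite mcoeffB !mcoeffXU eqxx eq_sym (negbTE ij).
by rewrite mcoeff0 subr0 => /eqP; rewrite oner_eq0.
Qed.

(** The reindexing [sigma] comes from the fact that a cluster is only known as a
    set. *)
Lemma fan_seed : exists (s : seed n iota) (sigma : 'I_n -> 'I_n),
  bijective sigma /\ forall i : 'I_n, cvar s i = fan_generator plain_label barred_label (sigma i).
Proof.
have [s _ sfan] := Acirc_triangulation hA (fan_triangulation n2) (fan_invariant n).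
have /choice [sigma sigmaE] (i : 'I_n) : exists k : 'I_n,
    cvar s i = fan_generator plain_label barred_label k.
  have [e efan ->] := (sfan (cvar s i)).1 (ex_intro _ i erefl).
  have [k [/andP[k1 kn] orb]] : exists k : vertex n, (1 < k <= n.+1)%N /\
      Theta_orbit e = orbit_of (vtx ord0) k.
    case/fanP: efan => k [kn ke]; exists k; split=> //.
    have -> : vtx (ord0 : 'I_n.+1) = 0 by apply: ord_inj; rewrite val_vtx.
    by case: ke => ->; rewrite -/(orbit_of _ _) ?orbit_of_bar.
  rewrite orb; have [kn'|kn'] := leqP k n.
    have kpn : (k.-1 < n)%N by lia.
    exists (Ordinal kpn); rewrite /fan_generator ifF /=; last by lia.
    have kE : k = vtx (lift ord0 (Ordinal kpn)).
      by apply: ord_inj; rewrite val_vtx /= /bump; lia.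
    rewrite [in LHS]kE /plain_label /labeled side_orbit_vtx //= ifF //.
    by rewrite /bump /=; lia.
  exists (Ordinal (ltnW n2)); rewrite /fan_generator /=.
  have kE : k = bar (vtx ord0).
    by apply: ord_inj; rewrite val_bar !val_vtx /=; lia.
  rewrite kE /barred_label /labeled side_orbit_vtx_bar //= ifF //; lia.
exists s, sigma; split=> //; apply: injF_bij => i j ij.
by apply: (@cvar_inj s); rewrite !sigmaE ij.
Qed.

Definition side_orbit k : {set {set vertex n}} := orbit_of (vtx k) (vtx k + 1).

Lemma side_orbit_in k : side_orbit k \in side_orbits n.
Proof. by rewrite side_orbit_pair is_side_pair eqxx. Qed.

(** Used to recover the exponents of a monomial in the sides from its value in
    the tropical semifield. *)
Lemma side_orbit_inj : injective side_orbit.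
Proof.
move=> k l; have hk := ltn_ord k; have hl := ltn_ord l.
move/Theta_orbit_eq; rewrite Theta_pair => -[] /pair_eq [] [] /(congr1 (@nat_of_ord _)) E
  /(congr1 (@nat_of_ord _)); move: E; rewrite ?val_bar ?val_vertexS ?val_bar ?val_vtx;
  do ?[case: ifP => ?]; move=> ? ?; apply: ord_inj; lia.
Qed.

Lemma side_generator_label k :
  side_generator plain_label barred_label k = iota (side_coef (side_orbit k)).
Proof.
have hk := ltn_ord k.
have -> : side_generator plain_label barred_label k = labeled iota x (side_orbit k).
  rewrite /side_generator /plain_label /barred_label /side_orbit; case: eqP => kn.
    rewrite orbit_of_barr orbit_ofC; congr (labeled _ _ (orbit_of _ _)).
      by apply: ord_inj; rewrite !val_vtx.
    by apply: ord_inj; rewrite val_vertexS val_bar !val_vtx /= kn; case: ifP; lia.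
  congr (labeled _ _ (orbit_of _ _)).
  by apply: ord_inj; rewrite val_vertexS !val_vtx inordK ?ifF //; lia.
by rewrite /labeled side_orbit_in.
Qed.

(** Distinct monomials in the sides are distinct elements of the coefficient
    group, hence linearly independent over the integers. *)
Lemma side_evaluation_inj :
  injective (mmap (intr : int -> F) (side_generator plain_label barred_label) : {mpoly int[n.+1]} -> F).
Proof.
apply: raddf_inj => p.
pose mon (m : 'X_{1..n.+1}) : tropC n := (\prod_k side_coef (side_orbit k) ^+ m k)%g.
pose j k : side_pair n := Sub (side_orbit k) (side_orbit_in k).
have monE m k : mon m (j k) = m k :> int.
  rewrite trop_prodE (bigD1 k) //= big1 => [|l lk]; rewrite trop_expE ffunE SubK.
    by rewrite eqxx addr0 natz.
  by rewrite (inj_eq side_orbit_inj) eq_sym (negbTE lk) mul0rn.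
(* A left inverse of [mon]; the absolute value only serves to return to naturals. *)
pose g (t : tropC n) : 'X_{1..n.+1} := [multinom `|t (j k)|%N | k < n.+1].
have gK m : g (mon m) = m by apply/mnmP => k; rewrite mnmE monE.
have iota_mon m : iota (mon m) = mmap1 (side_generator plain_label barred_label) m.
  rewrite /mon (big_morph iota (iota_mul hF) (iota1 hF)); apply: eq_bigr => k _.
  rewrite side_generator_label; elim: (m k) => [|e IH]; first by rewrite expg0 iota1.
  by rewrite expgS (iota_mul hF) IH exprS.
move=> p0; apply/mpolyP => m; rewrite mcoeff0.
have [mp|/memN_msupp_eq0 //] := boolP (m \in msupp p).
have := @iota_free _ _ _ _ hF [seq mon m' | m' <- msupp p] (fun t => p@_(g t)).
rewrite map_inj_uniq ?msupp_uniq => [/(_ isT)|]; last exact: can_inj gK.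
rewrite big_map => /(_ _ (mon m)); rewrite gK; apply; last exact: map_f.
rewrite -[RHS]p0; apply: eq_bigr => m' _.
by rewrite gK iota_mon -mulrzl.
Qed.

Lemma label_evaluation_inj (s : seed n iota) :
  injective (nested_eval (side_generator plain_label barred_label) (cvar s)).
Proof.
apply: raddf_inj => q; rewrite /= /nested_eval -meval_map_mpoly => q0.
have [indep _] := seed_basis s; apply: (map_mpoly_inj side_evaluation_inj).
rewrite raddf0; apply: indep q0; apply/mpolyOverP => m.
rewrite mcoeff_map_mpoly rpred_sum // => m' _; rewrite rpredM ?rpred_int //.
rewrite rpred_prod // => k _; rewrite rpredX // side_generator_label.
exact: iota_fracZP.
Qed.

End FanSeed.

(** A nonzero polynomial does not vanish at some point with nonzero coordinates,
    and that point is the tuple of minors of some matrix. *)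
Lemma Delta_evaluation_inj (C : numClosedFieldType) (n : nat) (sigma : 'I_n -> 'I_n) :
  (0 < n)%N -> bijective sigma ->
  injective (nested_eval (side_generator (@Delta C n) (@Deltabar C n))
    (fan_generator (@Delta C n) (@Deltabar C n) \o sigma)).
Proof.
move=> n0 [tau sK tK]; apply: raddf_inj => q q0; apply/eqP; apply: contraT.
case/(nested_eval_nonroot C) => s [t [s0 t0]]; apply: contraNT => _; apply/eqP.
have [M [sM tM]] := reconstruction n0 (t := t \o tau) s0 (fun i => t0 (tau i)).
have := congr1 (fun f => eval_mx f M) q0; rewrite /eval_mx raddf0 => <-.
symmetry; apply: nested_eval_morph => k /=; rewrite -/(eval_mx _ _).
  rewrite -sM /side_generator; case: ifP => _; [exact: eval_Deltabar | exact: eval_Delta].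
rewrite -[RHS](congr1 t (sK k)) -[RHS]/((t \o tau) (sigma k)) -tM /fan_generator.
by case: ifP => _; [exact: eval_Deltabar | exact: eval_Delta].
Qed.

(** * The isomorphism *)

Section Integrality.
Context (C : numClosedFieldType) (n : nat).
Local Notation inv := (so2_invariants C n).

Definition is_minor (r : inv) : Prop :=
  (exists a b : 'I_n.+1, (a < b)%N /\ \val r = Delta C a b) \/
  (exists a b : 'I_n.+1, (a <= b)%N /\ \val r = Deltabar C a b).

Definition minor_ring : subringClosed inv := subring_span is_minor.

Lemma minor_integral (r : subring_of minor_ring) :
  exists p : {mpoly int[2 * n.+1]}, \val (\val r) = map_mpoly intr p.
Proof.
move: (\val r) (valP r) => {}r.
have zE i a : zcoord C i a = map_mpoly intr 'X_(mxvec_index i a) by rewrite map_mpolyX.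
apply: (@subring_span_ind _ _ (fun r : inv => exists p : {mpoly int[2 * n.+1]},
  \val r = map_mpoly intr p)).
- by exists 1; rewrite !rmorph1.
- by move=> ? ? [p pE] [q qE]; exists (p - q); rewrite !rmorphB /= pE qE.
- by move=> ? ? [p pE] [q qE]; exists (p * q); rewrite !rmorphM /= pE qE.
pose X i (a : 'I_n.+1) : {mpoly int[2 * n.+1]} := 'X_(@mxvec_index 2 n.+1 i a).
move=> ? [[a [b [_ ->]]]|[a [b [_ ->]]]].
  exists (X 0 a * X 1 b - X 0 b * X 1 a).
  by rewrite /Delta !zE rmorphB !rmorphM.
exists (X 0 a * X 0 b + X 1 a * X 1 b).
by rewrite /Deltabar !zE rmorphD !rmorphM.
Qed.

Lemma minor_spanned (r : inv) : exists l : seq (C * subring_of minor_ring),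
  r = \sum_(y <- l) y.1 *: \val y.2.
Proof.
suff [l lE] : exists l : seq (C * subring_of minor_ring),
    \val r = \sum_(y <- l) y.1 *: \val (\val y.2).
  exists l; apply: val_inj; rewrite lE raddf_sum; apply: eq_bigr => y _.
  by [].
have gen (y : inv) : is_minor y -> exists l : seq (C * subring_of minor_ring),
    \val y = \sum_(y <- l) y.1 *: \val (\val y.2).
  by move=> /subring_span_gen ym; exists [:: (1, Sub y ym)]; rewrite big_seq1 scale1r SubK.
apply: (@so2_invariant_generated C n (fun f => exists l : seq (C * subring_of minor_ring),
  f = \sum_(y <- l) y.1 *: \val (\val y.2))) (valP r).
- by move=> c; exists [:: (c, 1)]; rewrite big_seq1 /= -mul_mpolyC mulr1.
- by move=> ? ? [l ->] [l' ->]; exists (l ++ l'); rewrite big_cat.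
- move=> ? ? [l ->] [l' ->]; exists [seq (y.1 * y'.1, y.2 * y'.2) | y <- l, y' <- l'].
  rewrite big_allpairs_dep mulr_suml; apply: eq_bigr => y _; rewrite mulr_sumr.
  by apply: eq_bigr => y' _; rewrite /= -scalerAl -scalerAr scalerA.
- move=> a b ab; have := gen (Sub (Delta C a b) (Delta_invariant C a b)); rewrite SubK; apply.
  by left; exists a, b.
- move=> a b ab; have := gen (Sub (Deltabar C a b) (Deltabar_invariant C a b)); rewrite SubK; apply.
  by right; exists a, b.
Qed.

Lemma minor_Zform : is_Zform minor_ring.
Proof.
apply: (@integral_subring_Zform C (2 * n.+1) inv minor_ring (\val : inv -> {mpoly C[2 * n.+1]})).
- exact: val_inj.
- exact: minor_integral.
- exact: minor_spanned.
Qed.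

End Integrality.

Section Isomorphism.
Context (C : numClosedFieldType) (n : nat) (F : fieldType) (iota : tropC n -> F).
Context (x : {set {set vertex n}} -> F) (s0 : seed n iota).
Hypotheses (n2 : (1 < n)%N) (hF : ambient_field n iota) (hA : is_Acirc x s0).

Local Notation mxpol := {mpoly C[2 * n.+1]}.
Local Notation A := (subring_of (cluster_algebra s0)).
Local Notation RZ := (subring_of (minor_ring C n)).
Local Notation U := (plain_label iota x).
Local Notation V := (barred_label iota x).

Definition label_pair (e : (F * mxpol)%type) : Prop :=
  (exists a b : 'I_n.+1, (a < b)%N /\ e = (U a b, Delta C a b)) \/
  (exists a b : 'I_n.+1, (a <= b)%N /\ e = (V a b, Deltabar C a b)).

(** The ring whose elements will be the pairs (w, image of w). *)
Definition graph : subringClosed (F * mxpol)%type := subring_span label_pair.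

Lemma fan_evaluations : exists (Q : idomainType) (phi : {rmorphism Q -> F})
    (phi' : {rmorphism Q -> mxpol}), [/\ injective phi, injective phi',
    forall k, exists q, phi q = fan_generator U V k /\
      phi' q = fan_generator (@Delta C n) (@Deltabar C n) k &
    forall k, exists q, phi q = side_generator U V k /\
      phi' q = side_generator (@Delta C n) (@Deltabar C n) k].
Proof.
have [s [sigma [sig cE]]] := fan_seed n2 hA.
have phi_inj := @label_evaluation_inj n F iota x n2 hF s.
have phi'_inj := @Delta_evaluation_inj C n sigma (ltnW n2) sig.
exists {mpoly {mpoly int[n.+1]}[n]}, (nested_eval (side_generator U V) (cvar s)),
  (nested_eval (side_generator (@Delta C n) (@Deltabar C n))
    (fan_generator (@Delta C n) (@Deltabar C n) \o sigma)).
split; [exact: phi_inj | exact: phi'_inj | move=> k | move=> k].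
  case: sig => tau _ tK; exists 'X_(tau k).
  split; first by apply: etrans (nested_eval_fan _ _ _) _; rewrite cE tK.
  by apply: etrans (nested_eval_fan _ _ _) _; rewrite /comp tK.
by exists ('X_k)%:MP; split; apply: nested_eval_side.
Qed.

Lemma graph_fraction : exists (Q : idomainType) (phi : {rmorphism Q -> F})
    (phi' : {rmorphism Q -> mxpol}), [/\ injective phi, injective phi' &
    forall e, e \in graph -> fraction_pair phi phi' e].
Proof.
have n1 : (0 < n)%N := ltnW n2.
have [Q [phi [phi' [phi_inj phi'_inj fan0 side0]]]] := fan_evaluations.
exists Q, phi, phi'; split=> //.
have fan k : fraction_pair phi phi'
    (fan_generator U V k, fan_generator (@Delta C n) (@Deltabar C n) k).
  by have [q [<- <-]] := fan0 k; apply: fraction_pair_gen.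
have side k : fraction_pair phi phi'
    (side_generator U V k, side_generator (@Delta C n) (@Deltabar C n) k).
  by have [q [<- <-]] := side0 k; apply: fraction_pair_gen.
pose W := fraction_pair phi phi'.
have [WU WV] : (forall i j : 'I_n.+1, (i < j)%N -> W (U i j, Delta C i j)) /\
    (forall i j : 'I_n.+1, W (V i j, Deltabar C i j)).
  apply: (@fan_generates n (F * mxpol)%type _ _ W (fun e => e.1 != 0)
    (ptolemy_pair (label_ptolemy_system n2 hF hA) (Delta_ptolemy_system C n))).
  - by move=> e e'; apply: fraction_pairD.
  - by move=> e e'; apply: fraction_pairM.
  - by move=> e e'; apply: fraction_pair_div.
  - by move=> i j ij; exact: (labeled_neq0 hF hA (vtx_neq ij)).
  - by move=> i j; exact: (labeled_neq0 hF hA (vtx_bar_neq n2 i j)).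
  - move=> j j0; have hj := ltn_ord j; have [j1|j1] := eqVneq (j : nat) 1%N.
      have := side ord0; rewrite /side_generator !ifF; try by rewrite /=; lia.
      by rewrite (_ : inord 1 = j) //; apply: ord_inj; rewrite inordK ?j1 //; lia.
    have hk : (j.-1 < n)%N by lia.
    have jE : lift ord0 (Ordinal hk) = j by apply: ord_inj; rewrite /= /bump; lia.
    by have := fan (Ordinal hk); rewrite /fan_generator !ifF ?jE //; rewrite /=; lia.
  - by have := fan (Ordinal n1).
  - by have := side ord_max; rewrite /side_generator /= eqxx.
  - move=> i j ij; have hj := ltn_ord j.
    have := side i; rewrite /side_generator !ifF; try by lia.
    by rewrite (_ : inord i.+1 = j) //; apply: ord_inj; rewrite inordK -?ij.
apply: subring_span_ind.
- exact: fraction_pair1.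
- exact: fraction_pairB.
- exact: fraction_pairM.
by move=> e [[a [b [ab ->]]]|[a [b [ab ->]]]]; [apply: WU | apply: WV].
Qed.

Lemma graph_eq0 e : e \in graph -> e.1 = 0 <-> e.2 = 0.
Proof.
have [Q [phi [phi' [inj inj' frac]]]] := graph_fraction.
by move/frac/(fraction_pair_eq0 inj inj').
Qed.

(** [graph] seen as a relation between the cluster algebra and the Z-form. *)
Definition corresponds (w : A) (r : RZ) : Prop := (\val w, \val (\val r)) \in graph.

(** Single-valuedness and injectivity at once, from [graph_eq0] applied to a
    difference. *)
Lemma corresponds_inj w r w' r' : corresponds w r -> corresponds w' r' ->
  w = w' <-> r = r'.
Proof.
move=> wr wr'; have := graph_eq0 (rpredB wr wr'); rewrite /= => E.
split=> e; apply/eqP; rewrite -subr_eq0; apply/eqP.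
  apply: val_inj; apply: val_inj; rewrite !rmorphB /= E.1 ?e ?subrr //=.
apply: val_inj; rewrite !rmorphB /= E.2 ?e ?subrr //=.
Qed.

Lemma corresponds_label (a b : 'I_n.+1) : (a < b)%N -> exists w r, [/\ corresponds w r,
  \val w = U a b & \val (\val r) = Delta C a b].
Proof.
move=> ab; have wA : U a b \in cluster_algebra s0.
  by apply: (label_cluster_algebra n2 hA); exists (vtx a), (vtx b); rewrite vtx_neq.
pose d : so2_invariants C n := Sub (Delta C a b) (Delta_invariant C a b).
have rI : d \in minor_ring C n.
  by apply: subring_span_gen; left; exists a, b.
exists (Sub (U a b) wA : A), (Sub d rI : RZ); split; rewrite /corresponds ?SubK //.
by apply: subring_span_gen; left; exists a, b.
Qed.

Lemma corresponds_label_bar (a b : 'I_n.+1) : (a <= b)%N -> exists w r, [/\ corresponds w r,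
  \val w = V a b & \val (\val r) = Deltabar C a b].
Proof.
move=> ab; have wA : V a b \in cluster_algebra s0.
  apply: (label_cluster_algebra n2 hA); exists (vtx a), (bar (vtx b)).
  by rewrite vtx_bar_neq.
pose d : so2_invariants C n := Sub (Deltabar C a b) (Deltabar_invariant C a b).
have rI : d \in minor_ring C n.
  by apply: subring_span_gen; right; exists a, b.
exists (Sub (V a b) wA : A), (Sub d rI : RZ); split; rewrite /corresponds ?SubK //.
by apply: subring_span_gen; right; exists a, b.
Qed.

Lemma corresponds1 : corresponds 1 1.
Proof. by rewrite /corresponds !rmorph1; exact: rpred1. Qed.

Lemma correspondsB w r w' r' : corresponds w r -> corresponds w' r' ->
  corresponds (w - w') (r - r').
Proof. by move=> wr wr'; rewrite /corresponds !rmorphB; exact: rpredB wr wr'. Qed.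

Lemma correspondsM w r w' r' : corresponds w r -> corresponds w' r' ->
  corresponds (w * w') (r * r').
Proof. by move=> wr wr'; rewrite /corresponds !rmorphM; exact: rpredM wr wr'. Qed.

Lemma corresponds_left (w : A) : exists r, corresponds w r.
Proof.
suff [w' [r [wr ww']]] : exists w' r, corresponds w' r /\ \val w' = \val w.
  by exists r; rewrite -(val_inj ww').
apply: (@subring_span_ind _ _ (fun v => exists w' r, corresponds w' r /\ \val w' = v))
  (cluster_algebra_sub_labels n2 hF hA (valP w)).
- by exists 1, 1; split; [exact: corresponds1 | rewrite rmorph1].
- move=> ? ? [w1 [r1 [wr1 <-]]] [w2 [r2 [wr2 <-]]]; exists (w1 - w2), (r1 - r2).
  by rewrite rmorphB; split=> //; apply: correspondsB.
- move=> ? ? [w1 [r1 [wr1 <-]]] [w2 [r2 [wr2 <-]]]; exists (w1 * w2), (r1 * r2).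
  by rewrite rmorphM; split=> //; apply: correspondsM.
move=> y [a [b [/orbit_pair_cases ab ->]]].
case: ab => -[i [j [ij ->]]].
  by have [w' [r [wr wE _]]] := corresponds_label ij; exists w', r.
by have [w' [r [wr wE _]]] := corresponds_label_bar ij; exists w', r.
Qed.

Lemma corresponds_right (r : RZ) : exists w, corresponds w r.
Proof.
suff [w [r' [wr rr']]] : exists w r', corresponds w r' /\ \val r' = \val r.
  by exists w; rewrite -(val_inj rr').
apply: (@subring_span_ind _ _ (fun v => exists w r', corresponds w r' /\ \val r' = v))
  (valP r).
- by exists 1, 1; split; [exact: corresponds1 | rewrite rmorph1].
- move=> ? ? [w1 [r1 [wr1 <-]]] [w2 [r2 [wr2 <-]]]; exists (w1 - w2), (r1 - r2).
  by rewrite rmorphB; split=> //; apply: correspondsB.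
- move=> ? ? [w1 [r1 [wr1 <-]]] [w2 [r2 [wr2 <-]]]; exists (w1 * w2), (r1 * r2).
  by rewrite rmorphM; split=> //; apply: correspondsM.
move=> y [[i [j [ij yE]]]|[i [j [ij yE]]]].
  have [w [r' [wr _ rE]]] := corresponds_label ij; exists w, r'; split=> //.
  by apply: val_inj; rewrite rE yE.
have [w [r' [wr _ rE]]] := corresponds_label_bar ij; exists w, r'; split=> //.
by apply: val_inj; rewrite rE yE.
Qed.

Lemma Zform_isomorphism_exists : exists (RZ : subringClosed (so2_invariants C n))
  (f : {rmorphism A -> subring_of RZ}), Zform_isomorphism x f.
Proof.
have [f fP] := choice corresponds_left; have [g gP] := choice corresponds_right.
have fE w r : corresponds w r -> f w = r.
  by move=> wr; apply/(corresponds_inj (fP w) wr).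
have f_zmod : zmod_morphism f by move=> w w'; apply: fE; apply: correspondsB.
have f_monoid : monoid_morphism f.
  by split=> [|w w']; apply: fE; [exact: corresponds1 | apply: correspondsM].
pose f' : {rmorphism A -> RZ} := HB.pack f
  (GRing.isZmodMorphism.Build A RZ f f_zmod)
  (GRing.isMonoidMorphism.Build A RZ f f_monoid).
exists (minor_ring C n), f'; split; first exact: minor_Zform.
  exists g => y /=; first by apply/(corresponds_inj (gP (f y)) (fP y)).
  exact: fE.
split=> a b ab.
  have [w [r [wr wE rE]]] := corresponds_label ab.
  by exists w => //; rewrite /= (fE w r).
have [w [r [wr wE rE]]] := corresponds_label_bar ab.
by exists w => //; rewrite /= (fE w r).
Qed.

(** The labels generate the cluster algebra. *)
Lemma extends_labels_unique (RZ1 RZ2 : subringClosed (so2_invariants C n))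
    (f1 : {rmorphism A -> subring_of RZ1}) (f2 : {rmorphism A -> subring_of RZ2}) :
  extends_labels x f1 -> extends_labels x f2 -> forall y, \val (f1 y) = \val (f2 y).
Proof.
move=> [U1 V1] [U2 V2] y.
suff [y' [E /val_inj <-]] : exists y', \val (f1 y') = \val (f2 y') /\ \val y' = \val y by [].
apply: (@subring_span_ind _ _ (fun v => exists y', \val (f1 y') = \val (f2 y') /\ \val y' = v))
  (cluster_algebra_sub_labels n2 hF hA (valP y)).
- by exists 1; rewrite !rmorph1.
- by move=> ? ? [w1 [E1 <-]] [w2 [E2 <-]]; exists (w1 - w2); rewrite !rmorphB /= E1 E2.
- by move=> ? ? [w1 [E1 <-]] [w2 [E2 <-]]; exists (w1 * w2); rewrite !rmorphM /= E1 E2.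
move=> v [a [b [/orbit_pair_cases ab ->]]].
case: ab => -[i [j [ij ->]]].
  have [y1 yE1 fE1] := U1 _ _ ij; have [y2 yE2 fE2] := U2 _ _ ij.
  have y12 : y1 = y2 by apply: val_inj; rewrite yE1 yE2.
  by exists y1; split=> //; apply: val_inj; rewrite fE1 y12 fE2.
have [y1 yE1 fE1] := V1 _ _ ij; have [y2 yE2 fE2] := V2 _ _ ij.
have y12 : y1 = y2 by apply: val_inj; rewrite yE1 yE2.
by exists y1; split=> //; apply: val_inj; rewrite fE1 y12 fE2.
Qed.

End Isomorphism.

Theorem proposition12p13 (R : realType) (n : nat) (hn : (2 <= n)%N)
    (F : fieldType) (iota : tropC n -> F) (hF : ambient_field n iota)
    (s0 : seed n iota) (x : {set {set vertex n}} -> F) (hA : is_Acirc x s0) :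
  (exists (RZ : subringClosed (so2_invariants R[i] n))
      (f : {rmorphism subring_of (cluster_algebra s0) -> subring_of RZ}),
      Zform_isomorphism x f) /\
  (forall (RZ RZ' : subringClosed (so2_invariants R[i] n))
      (f : {rmorphism subring_of (cluster_algebra s0) -> subring_of RZ})
      (f' : {rmorphism subring_of (cluster_algebra s0) -> subring_of RZ'}),
      Zform_isomorphism x f -> Zform_isomorphism x f' ->
      forall y, \val (f y) = \val (f' y)).
Proof.
split=> [|RZ RZ' f f' [_ _ fx] [_ _ f'x]].
  exact: (@Zform_isomorphism_exists R[i] n F iota x s0 hn hF hA).
exact: (@extends_labels_unique R[i] n F iota x s0 hn hF hA RZ RZ' f f' fx f'x).
Qed.
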